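(* Let $\mathcal{A}$ be a random set in $\mathcal{B}(n,\alpha)$ and $X := \deg \operatorname{lcm}\big([\mathcal{A}]_q\big)$, and let $\mathbb{V}[X]$ denote its variance. Then: (i) There exists a function $\mathrm{v} : (0,1) \to \mathbb{R}^+$ such that $\mathbb{V}[X] = (\mathrm{v}(\alpha) + o(1))\, n^3$ as $\alpha n / \big((\log n)^3 \log\log n\big) \to +\infty$; that is, for every $\varepsilon>0$ there exists $M>0$ such that for all integers $n\geq 3$ and all $\alpha\in(0,1)$ with $\alpha n/\big((\log n)^3\log\log n\big) \geq M$ one has $\big|\mathbb{V}[X]/n^3 - \mathrm{v}(\alpha)\big| \leq \varepsilon$. (ii) There is an absolute constant $C>0$ such that $\mathbb{V}[X] \leq C\,\alpha n^3$ for every positive integer $n$ and every $\alpha\in[0,1]$.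
   Context: For a positive integer $n$ and $\alpha\in[0,1]$, $\mathcal{B}(n,\alpha)$ denotes the probabilistic model in which a random set $\mathcal{A}\subseteq\{1,\dots,n\}$ is constructed by including each element of $\{1,\dots,n\}$ independently with probability $\alpha$. For an indeterminate $q$ and a positive integer $k$, $[k]_q := 1+q+\cdots+q^{k-1}\in\mathbb{Z}[q]$, and for a set $\mathcal{S}$ of positive integers $[\mathcal{S}]_q := \{[k]_q : k\in\mathcal{S}\}$. The least common multiple is taken in $\mathbb{Q}[q]$ (monic), with $\operatorname{lcm}(\varnothing)=1$ of degree $0$. *)

(* Defs.v *)
From HB Require Import structures.
From mathcomp Require Import all_boot all_order all_algebra.
From mathcomp Require Import reals exp.
Set Implicit Arguments. Unset Strict Implicit. Unset Printing Implicit Defensive.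
Import Order.TTheory GRing.Theory Num.Theory.
Local Open Scope ring_scope.

Definition qint (k : nat) : {poly rat} := \sum_(i < k) 'X^i.

Definition lcmp (p q : {poly rat}) : {poly rat} :=
  let l := (p * q) %/ gcdp p q in (lead_coef l)^-1 *: l.

Definition lcm_seq (s : seq {poly rat}) : {poly rat} := foldr lcmp 1 s.

(* degree of a polynomial (deg 0 := 0, irrelevant here) *)
Definition degp (p : {poly rat}) : nat := (size p).-1.

(* A subset of {1,...,n} is encoded as A : {set 'I_n}, index i standing for i+1. *)
Definition Xdeg (n : nat) (A : {set 'I_n}) : nat :=
  degp (lcm_seq [seq qint (nat_of_ord i).+1 | i : 'I_n <- enum A]).

Definition probB {R : realType} (n : nat) (alpha : R) (A : {set 'I_n}) : R :=
  alpha ^+ #|A| * (1 - alpha) ^+ (n - #|A|).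

Definition expectX {R : realType} (n : nat) (alpha : R) : R :=
  \sum_(A : {set 'I_n}) probB alpha A * (Xdeg A)%:R.

Definition varX {R : realType} (n : nat) (alpha : R) : R :=
  \sum_(A : {set 'I_n}) probB alpha A * ((Xdeg A)%:R - expectX n alpha) ^+ 2.

(* Main.v *)
Require Import Defs.
From HB Require Import structures.
From mathcomp Require Import classical_sets.
From mathcomp Require Import all_boot all_order all_algebra.
From mathcomp Require Import reals exp.
From mathcomp Require Import separable cyclotomic.
From mathcomp Require Import zify ring lra.
Set Implicit Arguments. Unset Strict Implicit. Unset Printing Implicit Defensive.
Import Order.TTheory GRing.Theory Num.Theory.
Local Open Scope ring_scope.

(* Since [k]_q is the product of the cyclotomic polynomials Phi_d over the
   divisors d > 1 of k, X is the sum of totient(d) over the d > 1 having a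
   multiple in A, and the variance is a double sum of
   totient(d) totient(e) cov(d, e) with nonnegative explicit covariances.  Writing
   d = g a and e = g b with a, b coprime, the covariance depends on n and g only
   through m = n %/ g, and it vanishes unless g a b <= n.  Hence the sum over g is
   a combination, with weights in [0, 1] depending on alpha, of increments of
   S(k) = sum_(g <= k) totient(g a) totient(g b) between n/(m+1) and n/m.
   As S(k)/k^3 converges and the total weight outside finitely many (a, b, m) is
   small independently of alpha, V[X]/n^3 converges uniformly on 0 < alpha < 1;
   for this the growth condition only has to force n to be large.  The limit is
   positive because the single term (a, b, m) = (1, 1, 1) already is, and the bound
   (ii) follows from cov(d, e) <= alpha n / lcm(d, e).

   Convergence of S(k)/k^3: totient(k)/k is the product of 1 - 1/p over the primes
   p dividing k; restricting to p < y gives a function of k of period y!, at a cost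
   O(1/y) in mean, and summation by parts brings in the factor g^2. *)

(** * The degree of the lcm via cyclotomic polynomials *)

Definition cyclotomic_rat (d : nat) : {poly rat} := map_poly intr 'Phi_d.

Lemma cyclotomic_rat_monic d : cyclotomic_rat d \is monic.
Proof. by rewrite monic_map ?Cyclotomic_monic. Qed.

Lemma size_cyclotomic_rat d : size (cyclotomic_rat d) = (totient d).+1.
Proof. by rewrite size_map_inj_poly ?size_Cyclotomic //; apply: intr_inj. Qed.

Lemma prod_cyclotomic_rat k :
  (0 < k)%N -> \prod_(d <- divisors k) cyclotomic_rat d = 'X^k - 1.
Proof.
move=> k0; rewrite -[RHS](_ : map_poly intr ('X^k - 1 : {poly int}) = _).
  by rewrite -prod_Cyclotomic // rmorph_prod.
by rewrite rmorphB rmorph1 /= map_polyXn.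
Qed.

(* Distinct cyclotomic polynomials are two factors of the separable polynomial
   X^(de) - 1. *)
Lemma coprimep_cyclotomic_rat d e : (0 < d)%N -> (0 < e)%N -> d != e ->
  coprimep (cyclotomic_rat d) (cyclotomic_rat e).
Proof.
move=> d0 e0 de; have k0 : (0 < d * e)%N by rewrite muln_gt0 d0.
have : separable_poly ('X^(d * e) - 1 : {poly rat}).
  by apply: separable_Xn_sub_1; rewrite pnatr_eq0 -lt0n.
rewrite -prod_cyclotomic_rat // (big_rem d) -?dvdn_divisors ?dvdn_mulr //=.
rewrite (big_rem e) ?mem_rem_uniq ?divisors_uniq ?inE 1?eq_sym ?de -?dvdn_divisors
  ?dvdn_mull //=; first by rewrite mulrA !separable_mul => /and3P[] /and3P[].
Qed.

(** The index starts at 2 because ['Phi_1] = X - 1 does not divide [k]_q. With a common bound [N],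
    forming lcms amounts to taking unions of predicates. *)
Definition cycloprod (N : nat) (P : pred nat) : {poly rat} :=
  \prod_(2 <= d < N | P d) cyclotomic_rat d.

Lemma cycloprod_monic N P : cycloprod N P \is monic.
Proof. by apply: monic_prod => d _; apply: cyclotomic_rat_monic. Qed.

Lemma eq_cycloprod N P Q : P =1 Q -> cycloprod N P = cycloprod N Q.
Proof. by move=> PQ; apply: eq_bigl. Qed.

Lemma cycloprodID N P Q :
  cycloprod N P = cycloprod N (predI P Q) * cycloprod N (predI P (predC Q)).
Proof. by rewrite /cycloprod (bigID Q). Qed.

Lemma coprimep_cycloprod N P Q : (forall d, ~~ (P d && Q d)) ->
  coprimep (cycloprod N P) (cycloprod N Q).
Proof.
move=> PQ; rewrite /cycloprod big_seq_cond.
apply: (big_ind (fun p => coprimep p (cycloprod N Q))) => [|p q hp hq|d].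
- exact: coprime1p.
- by rewrite coprimepMl hp.
rewrite mem_index_iota => /andP[/andP[d2 _] Pd]; rewrite /cycloprod big_seq_cond.
apply: (big_ind (fun q => coprimep (cyclotomic_rat d) q)) => [|p q hp hq|e].
- exact: coprimep1.
- by rewrite coprimepMr hp.
rewrite mem_index_iota => /andP[/andP[e2 _] Qe].
apply: coprimep_cyclotomic_rat; rewrite ?(ltnW d2) ?(ltnW e2) //.
by apply/eqP => de; move: (PQ d); rewrite Pd de Qe.
Qed.

(** Each product splits into its part over P and Q together and the rest. The two rests are coprime,
    so the gcd is the common part, up to a unit, and dividing by it leaves the product over the
    union. *)
Lemma lcmp_cycloprod N P Q :
  lcmp (cycloprod N P) (cycloprod N Q) = cycloprod N (predU P Q).
Proof.
rewrite /lcmp; set g := gcdp _ _; set l := _ %/ g.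
have g0 : cycloprod N (predI P Q) != 0 by apply/monic_neq0/cycloprod_monic.
have gE : g %= cycloprod N (predI P Q).
  rewrite /g (cycloprodID N P Q) (cycloprodID N Q P).
  rewrite (@eq_cycloprod N (predI Q P) (predI P Q)); last by move=> d /=; rewrite andbC.
  rewrite (eqp_trans (gcdp_mul2l _ _ _)) // -[X in _ %= X]mulr1 eqp_mul2l //.
  rewrite gcdp_eqp1; apply: coprimep_cycloprod => d /=.
  by case: (P d) (Q d) => -[].
have lE : l %= cycloprod N (predU P Q).
  rewrite /l (eqp_trans (eqp_divr _ gE)) //.
  rewrite (cycloprodID N (predU P Q) Q).
  rewrite (@eq_cycloprod N (predI (predU P Q) Q) Q); last first.
    by move=> d /=; case: (P d) (Q d) => -[].
  rewrite (@eq_cycloprod N (predI (predU P Q) (predC Q)) (predI P (predC Q))); last first.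
    by move=> d /=; case: (P d) (Q d) => -[].
  by rewrite (cycloprodID N P Q) mulrAC -mulrA mulKp // mulrC eqpxx.
have l0 : l != 0.
  apply: contraTneq lE => ->; rewrite eqp_sym eqp0.
  exact/monic_neq0/cycloprod_monic.
(* Associated monic polynomials are equal, and [lcmp] normalises its leading coefficient. *)
apply/eqP; rewrite -eqp_monic ?cycloprod_monic //; last first.
  by rewrite monicE lead_coefZ mulVf // lead_coef_eq0.
by rewrite (eqp_trans _ lE) // eqp_scale // invr_eq0 lead_coef_eq0.
Qed.

(** Multiplied by X - 1, which is the factor at d = 1, both sides become X^k - 1. *)
Lemma qint_cycloprod N k : (0 < k < N)%N ->
  qint k = cycloprod N (fun d => (d %| k)%N).
Proof.
move=> /andP[k0 kN].
have X1 : 'X - 1 != 0 :> {poly rat} by rewrite -[1]/(1%:P) polyXsubC_eq0.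
apply: (mulfI X1).
have -> : ('X - 1) * qint k = 'X^k - 1.
  by rewrite /qint subrX1.
rewrite -prod_cyclotomic_rat // (big_rem 1%N) -?dvdn_divisors ?dvd1n //=.
congr (_ * _).
  have := @prod_cyclotomic_rat 1 isT; rewrite expr1 => <-.
  by rewrite (_ : divisors 1 = [:: 1%N]) // big_seq1.
rewrite /cycloprod -[RHS]big_filter; apply: perm_big; apply: uniq_perm.
- by rewrite rem_uniq // divisors_uniq.
- by rewrite filter_uniq // iota_uniq.
move=> d; rewrite mem_rem_uniq ?divisors_uniq // inE mem_filter mem_index_iota.
rewrite -dvdn_divisors // andbC; case: (boolP (d %| k)%N) => //= dk.
have := dvdn_leq k0 dk; have := dvdn_gt0 k0 dk; lia.
Qed.

Lemma lcm_seq_qint N (s : seq nat) : all (fun k => 0 < k < N)%N s ->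
  lcm_seq [seq qint k | k <- s] = cycloprod N (fun d => has (dvdn d) s).
Proof.
elim: s => [|k s IHs] /=; first by rewrite /cycloprod big_pred0_eq.
move=> /andP[kN sN]; rewrite IHs // (@qint_cycloprod N) // lcmp_cycloprod.
exact: eq_cycloprod.
Qed.

Lemma size_cycloprod N P :
  size (cycloprod N P) = (\sum_(2 <= d < N | P d) totient d).+1.
Proof.
suff [] : cycloprod N P \is monic /\
  size (cycloprod N P) = (\sum_(2 <= d < N | P d) totient d).+1 by [].
apply: (big_rec2 (fun (p : {poly rat}) m => p \is monic /\ size p = m.+1)).
  by rewrite monic1 size_poly1.
move=> d p m _ [pm ps]; split; first by rewrite monicMl ?cyclotomic_rat_monic.
rewrite size_monicM ?cyclotomic_rat_monic ?monic_neq0 //.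
by rewrite size_cyclotomic_rat ps /= addnS.
Qed.

Definition hit {n} (A : {set 'I_n}) (d : nat) : bool :=
  [exists i in A, (d %| i.+1)%N].

Lemma Xdeg_totient n (A : {set 'I_n}) :
  Xdeg A = (\sum_(2 <= d < n.+1 | hit A d) totient d)%N.
Proof.
rewrite /Xdeg /degp.
have -> : [seq qint i.+1 | i : 'I_n <- enum A]
          = [seq qint k | k <- [seq i.+1 | i : 'I_n <- enum A]].
  by rewrite -map_comp.
rewrite (@lcm_seq_qint n.+1); last first.
  by apply/allP => _ /mapP[i _ ->]; exact: (ltn_ord i).
rewrite size_cycloprod; apply: eq_bigl => d; apply/hasP/exists_inP.
  by case=> _ /mapP[i iA ->] di; exists i; rewrite // -mem_enum.
by case=> i iA di; exists i.+1 => //; apply/mapP; exists i; rewrite ?mem_enum.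
Qed.

(** * The variance as a double sum *)

(** The right side is a product over i of two summands: alpha, replaced by 0 when i lies in [S], and
    1 - alpha. Expanding, [A] records where the first summand is chosen, so sets meeting [S]
    contribute 0. *)
Lemma sum_probB_disjoint (R : realType) n (alpha : R) (S : {set 'I_n}) :
  \sum_(A : {set 'I_n}) probB alpha A * [disjoint A & S]%:R = (1 - alpha) ^+ #|S|.
Proof.
have -> : (1 - alpha) ^+ #|S| =
    \prod_(i < n) ((if i \in S then 0 else alpha) + (1 - alpha)).
  rewrite (bigID (mem S)) /= [X in _ * X]big1 ?mulr1; last first.
    by move=> i /negbTE ->; rewrite addrC subrK.
  under eq_bigr => i iS do rewrite iS add0r.
  by rewrite prodr_const.
rewrite bigA_distr; apply: eq_big => [A|A _]; first by [].
rewrite (bigID (mem A)) /=.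
under [X in _ = X * _]eq_bigr => i iA do rewrite iA.
under [X in _ = _ * X]eq_bigr => i iA do rewrite (negbTE iA).
have -> : \prod_(i < n | i \notin A) (1 - alpha) = (1 - alpha) ^+ (n - #|A|).
  rewrite prodr_const; congr (_ ^+ _).
  have AC : (#|A| + #|[predC A]| = n)%N by rewrite cardC card_ord.
  by transitivity #|[predC A]|; [apply: eq_card => i; rewrite !inE | lia].
case: (boolP [disjoint A & S]) => [dAS|/pred0Pn[i /andP[/= iA iS]]].
  rewrite mulr1 /probB; congr (_ * _); rewrite -prodr_const.
  by apply: eq_bigr => i iA; rewrite (disjointFr dAS iA).
by rewrite mulr0 (bigD1 i) //= iS mul0r mul0r.
Qed.

Lemma sum_probB (R : realType) n (alpha : R) :
  \sum_(A : {set 'I_n}) probB alpha A = 1.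
Proof.
rewrite -[RHS](expr0 (1 - alpha)) -(cards0 'I_n) -sum_probB_disjoint.
by apply: eq_bigr => A _; rewrite -setI_eq0 setI0 eqxx mulr1.
Qed.

Definition multiples n (d : nat) : {set 'I_n} := [set i : 'I_n | (d %| i.+1)%N].

Lemma card_multiples n d : (0 < d)%N -> #|multiples n d| = (n %/ d)%N.
Proof.
move=> d0; rewrite cardsE -sum1_card.
rewrite (eq_bigl (fun i : 'I_n => d %| i.+1)%N) //.
rewrite big_mkcond -(big_mkord xpredT (fun i => if (d %| i.+1)%N then 1 else 0)%N).
elim: n => [|n IHn]; first by rewrite big_nil div0n.
by rewrite big_nat_recr //= IHn divnS // addnC; case: (d %| n.+1)%N.
Qed.

Lemma multiplesI n d e : multiples n d :&: multiples n e = multiples n (lcmn d e).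
Proof. by apply/setP => i; rewrite !inE dvdn_lcm. Qed.

Lemma hit_multiples n (A : {set 'I_n}) d :
  hit A d = ~~ [disjoint A & multiples n d].
Proof.
apply/exists_inP/pred0Pn => [[i iA di]|[i /andP[/= iA]]].
  by exists i; rewrite /= iA inE.
by rewrite inE => di; exists i.
Qed.

(** Covariance of the events that [A] misses all multiples of d, respectively of e, with [beta] = 1
    - alpha. The first exponent counts the multiples of d or of e by inclusion-exclusion. *)
Definition miss_cov {R : realType} (beta : R) (n d e : nat) : R :=
  beta ^+ (n %/ d + n %/ e - n %/ lcmn d e) * (1 - beta ^+ (n %/ lcmn d e)).

Lemma miss_covE (R : realType) (alpha : R) n d e : (0 < d)%N -> (0 < e)%N ->
  miss_cov (1 - alpha) n d e =
  \sum_(A : {set 'I_n}) probB alpha A *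
    (((1 - alpha) ^+ (n %/ d) - (~~ hit A d)%:R) *
     ((1 - alpha) ^+ (n %/ e) - (~~ hit A e)%:R)).
Proof.
move=> d0 e0; have L0 : (0 < lcmn d e)%N by rewrite lcmn_gt0 d0.
set b := 1 - alpha.
have miss1 c : (0 < c)%N ->
    \sum_(A : {set 'I_n}) probB alpha A * (~~ hit A c)%:R = b ^+ (n %/ c).
  move=> c0; rewrite -card_multiples // -sum_probB_disjoint.
  by apply: eq_bigr => A _; rewrite hit_multiples negbK.
have miss2 : \sum_(A : {set 'I_n}) probB alpha A * ((~~ hit A d)%:R * (~~ hit A e)%:R)
    = b ^+ (n %/ d + n %/ e - n %/ lcmn d e).
  rewrite -!card_multiples // -multiplesI -cardsU -sum_probB_disjoint.
  apply: eq_bigr => A _; rewrite !hit_multiples !negbK -natrM mulnb.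
  by rewrite -!setI_eq0 setIUr setU_eq0.
have -> : \sum_(A : {set 'I_n}) probB alpha A *
    ((b ^+ (n %/ d) - (~~ hit A d)%:R) * (b ^+ (n %/ e) - (~~ hit A e)%:R)) =
  \sum_(A : {set 'I_n}) (probB alpha A * (b ^+ (n %/ d) * b ^+ (n %/ e))
   - probB alpha A * (~~ hit A d)%:R * b ^+ (n %/ e)
   - probB alpha A * (~~ hit A e)%:R * b ^+ (n %/ d)
   + probB alpha A * ((~~ hit A d)%:R * (~~ hit A e)%:R)).
  by apply: eq_bigr => A _; ring.
rewrite big_split !sumrB /= -!mulr_suml sum_probB !miss1 // miss2.
(* The truncated subtraction in the exponent is exact since n/lcm(d,e) is at most n/d. *)
rewrite /miss_cov mulrBr mulr1 -[X in _ - X = _]exprD subnK ?exprD; first by ring.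
apply: leq_trans (leq_addr _ _).
by rewrite leq_div2l // dvdn_leq ?dvdn_lcml.
Qed.

Lemma varX_miss_cov (R : realType) (alpha : R) n :
  varX n alpha = \sum_(2 <= d < n.+1) \sum_(2 <= e < n.+1)
    (totient d)%:R * (totient e)%:R * miss_cov (1 - alpha) n d e.
Proof.
set b := 1 - alpha.
have XE (A : {set 'I_n}) : (Xdeg A)%:R =
    \sum_(2 <= d < n.+1) (totient d)%:R * (1 - (~~ hit A d)%:R) :> R.
  rewrite Xdeg_totient natr_sum big_mkcond; apply: eq_bigr => d _.
  by case: (hit A d); rewrite /= ?subr0 ?mulr1 // subrr mulr0.
have muE : expectX n alpha = \sum_(2 <= d < n.+1) (totient d)%:R * (1 - b ^+ (n %/ d)).
  rewrite /expectX; under eq_bigr do rewrite XE mulr_sumr.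
  rewrite exchange_big /= big_seq [RHS]big_seq; apply: eq_bigr => d.
  rewrite mem_index_iota => /andP[d2 _].
  have -> : \sum_(A : {set 'I_n}) probB alpha A * ((totient d)%:R * (1 - (~~ hit A d)%:R))
     = (totient d)%:R * (\sum_(A : {set 'I_n}) probB alpha A -
          \sum_(A : {set 'I_n}) probB alpha A * (~~ hit A d)%:R).
    by rewrite -sumrB mulr_sumr; apply: eq_bigr => A _; ring.
  rewrite sum_probB -card_multiples ?(ltnW d2) // -sum_probB_disjoint.
  congr (_ * (_ - _)); apply: eq_bigr => A _.
  by rewrite hit_multiples negbK.
(* The deviation of X is a combination of centred indicators; squaring it produces the
   covariances. *)
have dev (A : {set 'I_n}) : (Xdeg A)%:R - expectX n alpha =
    \sum_(2 <= d < n.+1) (totient d)%:R * (b ^+ (n %/ d) - (~~ hit A d)%:R).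
  by rewrite XE muE -sumrB; apply: eq_bigr => d _; ring.
rewrite /varX; under eq_bigr do rewrite dev expr2 mulr_suml mulr_sumr.
rewrite exchange_big /= big_seq [RHS]big_seq; apply: eq_bigr => d.
rewrite mem_index_iota => /andP[d2 _].
under eq_bigr do rewrite mulr_sumr mulr_sumr.
rewrite exchange_big /= big_seq [RHS]big_seq; apply: eq_bigr => e.
rewrite mem_index_iota => /andP[e2 _].
rewrite miss_covE ?(ltnW d2) ?(ltnW e2) // mulr_sumr.
by apply: eq_bigr => A _; ring.
Qed.

(** * Mean values *)

Section MeanValues.
Variable R : realType.
Implicit Types (F P : nat -> R) (c eps Q : R).

Lemma sum1S F j :
  \sum_(1 <= g < j.+2) F g = \sum_(1 <= g < j.+1) F g + F j.+1.
Proof. by rewrite big_nat_recr. Qed.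

(** The constant is the average over one period. Full periods cancel exactly and only an incomplete
    one remains. *)
Lemma periodic_mean P (q : nat) : (0 < q)%N ->
  (forall g, P (g + q)%N = P g) -> (forall g, 0 <= P g <= 1) ->
  exists c, forall j, `|\sum_(1 <= g < j.+1) P g - c * j%:R| <= q%:R.
Proof.
move=> q0 Pper P01; pose A j := \sum_(1 <= g < j.+1) P g.
have AS j : A j.+1 = A j + P j.+1 by rewrite /A sum1S.
have A0 : A 0%N = 0 by rewrite /A big_geq.
have AD j : A (j + q)%N = A j + A q.
  elim: j => [|j IHj]; first by rewrite add0n A0 add0r.
  by rewrite addSn !AS IHj -addSn Pper addrAC.
have A01 j : 0 <= A j <= j%:R.
  elim: j => [|j /andP[h1 h2]]; first by rewrite A0 lexx.
  have /andP[h3 h4] := P01 j.+1.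
  by rewrite AS addr_ge0 //= -natr1 lerD.
have qR : 0 < q%:R :> R by rewrite ltr0n.
exists (A q / q%:R) => j; rewrite -/(A j).
have AM k s : A (k * q + s)%N = A q * k%:R + A s.
  elim: k => [|k IHk]; first by rewrite mul0n mulr0 add0n add0r.
  have -> : (k.+1 * q + s = k * q + s + q)%N by lia.
  by rewrite AD IHk -natr1; ring.
set k := (j %/ q)%N; set s := (j %% q)%N.
have jE : j%:R = k%:R * q%:R + s%:R :> R by rewrite -natrM -natrD -divn_eq.
have -> : A j = A q * k%:R + A s by rewrite -AM -divn_eq.
rewrite jE.
have sq : s%:R <= q%:R :> R by rewrite ler_nat ltnW // ltn_pmod.
have -> : A q * k%:R + A s - A q / q%:R * (k%:R * q%:R + s%:R)
    = A s - A q / q%:R * s%:R by field; rewrite gt_eqF.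
have /andP[h1 h2] := A01 s; have /andP[h3 h4] := A01 q.
have h5 : A q / q%:R <= 1 by rewrite ler_pdivrMr // mul1r.
have h6 : 0 <= A q / q%:R by rewrite divr_ge0.
have h7 : A q / q%:R * s%:R <= s%:R by rewrite ler_piMl.
have h8 : 0 <= A q / q%:R * s%:R by rewrite mulr_ge0.
by rewrite ler_norml; apply/andP; split; lra.
Qed.

Lemma sum_sqr (k : nat) :
  \sum_(1 <= g < k.+1) (g%:R ^+ 2 : R) = k%:R ^+ 3 / 3 + k%:R ^+ 2 / 2 + k%:R / 6.
Proof.
elim: k => [|k IHk]; first by rewrite big_geq //; field.
by rewrite sum1S IHk -natr1; field.
Qed.

(** With D(j) the discrepancy of the partial sums, summation by parts leaves k^2 D(k) and a sum of
    D(g) with weights (g+1)^2 - g^2 = 2g+1 of total k^2; each is at most k^2 (eps k + Q). The term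
    |c| k^2 absorbs the lower-order part of the sum of squares. *)
Lemma abel_sqr_mean F c eps Q : 0 <= eps -> 0 <= Q ->
  (forall j, `|\sum_(1 <= g < j.+1) F g - c * j%:R| <= eps * j%:R + Q) ->
  forall k, `|\sum_(1 <= g < k.+1) g%:R ^+ 2 * F g - c / 3 * k%:R ^+ 3|
    <= 2 * eps * k%:R ^+ 3 + (2 * Q + `|c|) * k%:R ^+ 2.
Proof.
move=> e0 Q0 FM k; pose D j := \sum_(1 <= g < j.+1) F g - c * j%:R.
have DS j : D j.+1 = D j + F j.+1 - c.
  by rewrite /D sum1S -natr1; ring.
have D0 : D 0%N = 0 by rewrite /D big_geq // mulr0 subrr.
have FE j : \sum_(1 <= g < j.+1) g%:R ^+ 2 * F g =
    c * (\sum_(1 <= g < j.+1) g%:R ^+ 2) + j%:R ^+ 2 * D j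
    - \sum_(0 <= g < j) (2 * g%:R + 1) * D g.
  elim: j => [|j IHj]; first by rewrite !big_geq //; ring.
  by rewrite !sum1S (big_nat_recr j 0%N) //= IHj DS -natr1; ring.
rewrite FE sum_sqr.
have DB j : (j <= k)%N -> `|D j| <= eps * k%:R + Q.
  move=> jk; apply: le_trans (FM j) _; rewrite lerD2r ler_wpM2l //.
  by rewrite ler_nat.
have h1 : `|k%:R ^+ 2 * D k| <= k%:R ^+ 2 * (eps * k%:R + Q).
  by rewrite normrM normrX normr_nat ler_wpM2l ?DB // exprn_ge0.
have odd_sum j : \sum_(0 <= g < j) (2 * g%:R + 1) = j%:R ^+ 2 :> R.
  elim: j => [|j IHj]; first by rewrite big_geq // expr0n.
  by rewrite big_nat_recr //= IHj -natr1; ring.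
have h2 : `|\sum_(0 <= g < k) (2 * g%:R + 1) * D g| <= k%:R ^+ 2 * (eps * k%:R + Q).
  rewrite -odd_sum mulr_suml; apply: le_trans (ler_norm_sum _ _ _) _.
  rewrite big_nat [leRHS]big_nat; apply: ler_sum => g /andP[_ gk].
  rewrite normrM ger0_norm; last by rewrite addr_ge0 // mulr_ge0.
  by rewrite ler_wpM2l ?DB 1?ltnW // addr_ge0 // mulr_ge0.
have h3 : `|c * (k%:R ^+ 2 / 2 + k%:R / 6)| <= `|c| * k%:R ^+ 2.
  rewrite normrM ler_wpM2l //.
  have k0 : 0 <= k%:R :> R by [].
  have k2 : k%:R <= k%:R ^+ 2 :> R by rewrite -natrX ler_nat; case: (k) => // m; nia.
  by rewrite ger0_norm; lra.
set S := \sum_(0 <= g < k) _ in h2 *.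
have -> : c * (k%:R ^+ 3 / 3 + k%:R ^+ 2 / 2 + k%:R / 6) + k%:R ^+ 2 * D k - S
    - c / 3 * k%:R ^+ 3 = c * (k%:R ^+ 2 / 2 + k%:R / 6) + k%:R ^+ 2 * D k - S by field.
apply: le_trans (ler_normB _ _) _.
apply: le_trans (lerD (ler_normD _ _) (lexx _)) _.
have -> : 2 * eps * k%:R ^+ 3 + (2 * Q + `|c|) * k%:R ^+ 2 =
  `|c| * k%:R ^+ 2 + k%:R ^+ 2 * (eps * k%:R + Q) + k%:R ^+ 2 * (eps * k%:R + Q) by ring.
by rewrite !lerD.
Qed.

(** Telescoping, from 1/(x+1)^2 <= 1/x - 1/(x+1). *)
Lemma sum_inv_sqr_tail (T N : nat) : (0 < T)%N ->
  \sum_(T.+1 <= a < N) (a%:R ^- 2 : R) <= T%:R^-1.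
Proof.
move=> T0; have t0 : 0 < T%:R :> R by rewrite ltr0n.
have [NT|TN] := leqP N T.+1; first by rewrite big_geq // invr_ge0.
suff : \sum_(T.+1 <= a < N) (a%:R ^- 2 : R) <= T%:R^-1 - N.-1%:R^-1.
  by move=> /le_trans; apply; rewrite gerBl invr_ge0.
rewrite -(subnKC TN); elim: (N - T.+2)%N => [|m IHm].
  rewrite addn0 big_nat1 /= -natr1.
  rewrite -subr_ge0 (_ : _ - _ = (T%:R * (T%:R + 1) ^+ 2)^-1).
    by rewrite invr_ge0 mulr_ge0 // exprn_ge0 // addr_ge0.
  by field; lra.
have -> : (T.+2 + m.+1 = (T.+2 + m).+1)%N by lia.
rewrite big_nat_recr /=; last by lia.
move: IHm; rewrite addSn /=; set x := (T.+1 + m)%N => IHm.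
have x0 : 0 < x%:R :> R by rewrite ltr0n; lia.
apply: le_trans (lerD IHm (lexx _)) _.
rewrite -subr_ge0 -natr1 (_ : _ - _ = (x%:R * (x%:R + 1) ^+ 2)^-1).
  by rewrite invr_ge0 mulr_ge0 ?(ltW x0) // exprn_ge0 // addr_ge0 ?(ltW x0).
by field; lra.
Qed.

Lemma sum_inv_sqr (N : nat) : \sum_(1 <= a < N) (a%:R ^- 2 : R) <= 2.
Proof.
have [N1|N1] := leqP N 1; first by rewrite big_geq.
rewrite big_ltn // expr1n invr1 (natrD _ 1 1) lerD2l.
by apply: le_trans (@sum_inv_sqr_tail 1 N isT) _; rewrite invr1.
Qed.

End MeanValues.

(** * Mean values of totients *)

Section TotientMean.
Variable R : realType.

Definition totient_ratio (k : nat) : R := (totient k)%:R / k%:R.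

(** Euler product of [totient_ratio] cut at the primes below [y]. *)
Definition trunc_ratio (y k : nat) : R :=
  \prod_(0 <= p < y | prime p && (p %| k)%N) (1 - p%:R^-1).

(** Bounds the loss when the Euler product is cut at [y] instead of [K]. *)
Definition prime_tail (y K k : nat) : R :=
  \sum_(y <= p < K | prime p && (p %| k)%N) p%:R^-1.

Lemma totient_trunc_ratio K k : (0 < k < K)%N -> totient_ratio k = trunc_ratio K k.
Proof.
move=> /andP[k0 kK]; rewrite /totient_ratio /trunc_ratio.
have kR : k%:R != 0 :> R by rewrite pnatr_eq0 -lt0n.
apply: (mulIf kR); rewrite divfK // totientE //.
have -> : \prod_(0 <= p < K | prime p && (p %| k)%N) (1 - p%:R^-1) =
          \prod_(p <- primes k) (1 - p%:R^-1) :> R.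
  rewrite -[LHS]big_filter; apply: perm_big; apply: uniq_perm.
  - by rewrite filter_uniq // iota_uniq.
  - exact: primes_uniq.
  move=> p; rewrite mem_filter mem_index_iota mem_primes k0 /=.
  case: (prime p) => //=; case: (boolP (p %| k)%N) => //= pk.
  by rewrite (leq_ltn_trans (dvdn_leq k0 pk)).
have -> : k%:R = \prod_(p <- primes k) (p%:R ^+ logn p k) :> R.
  rewrite [in LHS](prod_prime_decomp k0) prime_decompE big_map /= natr_prod.
  by apply: eq_bigr => p _; rewrite natrX.
rewrite natr_prod -big_split /= big_seq [RHS]big_seq; apply: eq_bigr => p.
rewrite mem_primes => /and3P[pp _ pk].
have p0 : p%:R != 0 :> R by rewrite pnatr_eq0 -lt0n prime_gt0.
have l0 : (0 < logn p k)%N by rewrite logn_gt0 mem_primes pp k0.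
rewrite -[in RHS](prednK l0) exprS mulrA natrM natrX; congr (_ * _).
by rewrite mulrBl mul1r mulVf // -subn1 natrB ?prime_gt0.
Qed.

Lemma inv_nat01 (p : nat) : 0 <= 1 - (p%:R^-1 : R) <= 1.
Proof.
rewrite subr_ge0 gerBl invr_ge0 ler0n andbT.
by case: p => [|p]; rewrite ?invr0 // invf_le1 ?ler1n ?ltr0n.
Qed.

Lemma trunc_ratio01 y k : 0 <= trunc_ratio y k <= 1.
Proof.
rewrite /trunc_ratio; apply: (big_ind (fun x : R => 0 <= x <= 1)).
- by rewrite ler01 lexx.
- move=> x z /andP[x0 x1] /andP[z0 z1].
  by rewrite mulr_ge0 //= mulr_ile1.
- by move=> p _; apply: inv_nat01.
Qed.

Lemma totient_ratio01 k : 0 <= totient_ratio k <= 1.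
Proof.
case: k => [|k]; first by rewrite /totient_ratio invr0 mulr0 lexx ler01.
by rewrite (@totient_trunc_ratio k.+2) ?ltnSn // trunc_ratio01.
Qed.

(** Weierstrass product inequality. The induction also needs the product to stay in [0, 1]. *)
Lemma prod_1B_ge (r : seq nat) (P : pred nat) (F : nat -> R) :
  (forall p, 0 <= F p <= 1) ->
  1 - \sum_(p <- r | P p) F p <= \prod_(p <- r | P p) (1 - F p) <= 1.
Proof.
move=> F01; suff : 0 <= \prod_(p <- r | P p) (1 - F p) <= 1 /\
   1 - \sum_(p <- r | P p) F p <= \prod_(p <- r | P p) (1 - F p).
  by move=> [/andP[_ ->] ->].
elim: r => [|p r [/andP[h0 h1] h2]]; first by rewrite !big_nil; lra.
rewrite !big_cons; case: (P p); last by rewrite h0 h1 h2.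
have /andP[f0 f1] := F01 p.
set x := \prod_(_ <- _ | _) _ in h0 h1 h2 *; set s := \sum_(_ <- _ | _) _ in h2 *.
by split; nra.
Qed.

Lemma trunc_ratio_tail y K k : (y <= K)%N ->
  0 <= trunc_ratio y k - trunc_ratio K k <= prime_tail y K k.
Proof.
move=> yK; have -> : trunc_ratio K k = trunc_ratio y k *
    \prod_(y <= p < K | prime p && (p %| k)%N) (1 - p%:R^-1).
  by rewrite /trunc_ratio -big_cat_nat.
have /andP[t0 t1] := trunc_ratio01 y k.
have /andP := @prod_1B_ge (index_iota y K) (fun p => prime p && (p %| k)%N)
  (fun p => p%:R^-1) (fun p => ltac:(by have := inv_nat01 p; lra)).
rewrite -/(prime_tail y K k); set x := \prod_(_ <= _ < _ | _) _ => -[h1 h2].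
have s0 : 0 <= prime_tail y K k by apply: sumr_ge0 => p _; rewrite invr_ge0.
by apply/andP; split; nra.
Qed.

Lemma trunc_ratioD y k t : trunc_ratio y (k + t * y`!) = trunc_ratio y k.
Proof.
rewrite /trunc_ratio big_nat_cond [RHS]big_nat_cond; apply: eq_bigl => p.
case: (boolP (0 <= p < y)%N) => //= py; case: (boolP (prime p)) => //= pp.
by rewrite dvdn_addl // dvdn_mull // dvdn_fact // prime_gt0 // ltnW.
Qed.

Lemma count_multiples (p j : nat) : (0 < p)%N ->
  \sum_(1 <= g < j.+1 | (p %| g)%N) (1 : R) = (j %/ p)%:R.
Proof.
move=> p0; rewrite big_mkcond; elim: j => [|j IHj]; first by rewrite big_geq // div0n.
by rewrite sum1S IHj divnS // addnC natrD; case: (p %| j.+1)%N.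
Qed.

(** As a < y, a prime p >= y divides ga only if it divides g, which happens for at most j/p values
    of g. With weight 1/p this gives j/p^2, and the tail of the inverse squares gives 1/(y-1). *)
Lemma sum_prime_tail (a y K j : nat) : (0 < a)%N -> (a < y)%N -> (1 < y)%N ->
  \sum_(1 <= g < j.+1) prime_tail y K (g * a) <= j%:R / y.-1%:R.
Proof.
move=> a0 ay y1; rewrite /prime_tail (exchange_big_dep_nat xpredT) //=.
apply: (@le_trans _ _ (\sum_(y <= p < K) j%:R * p%:R ^- 2)); last first.
  rewrite -mulr_sumr ler_wpM2l //.
  have yE : y = y.-1.+1 by rewrite prednK // ltnW.
  by rewrite {1}yE; apply: sum_inv_sqr_tail; rewrite -ltnS -yE.
rewrite big_nat [leRHS]big_nat; apply: ler_sum => p /andP[yp pK].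
have p0 : (0 < p)%N by lia.
case: (boolP (prime p)) => [pp|_]; last first.
  by rewrite big_pred0_eq mulr_ge0 // invr_ge0 exprn_ge0.
have -> : \sum_(1 <= g < j.+1 | true && (p %| g * a)%N) (p%:R^-1 : R)
    = (j %/ p)%:R / p%:R.
  rewrite -count_multiples // mulr_suml; apply: eq_big => [g|g _]; last by rewrite mul1r.
  rewrite Gauss_dvdl // prime_coprime //; apply/negP => /(dvdn_leq a0); lia.
rewrite -exprVn expr2 mulrA ler_wpM2r ?invr_ge0 //.
by rewrite ler_pdivlMr ?ltr0n // -natrM ler_nat leq_trunc_div.
Qed.

(** The constant c may depend on eps: approximation to every precision is all that is used later, so
    the exact mean value is never named. *)
Lemma totient_ratio_mean (a b : nat) (eps : R) : (0 < a)%N -> (0 < b)%N -> 0 < eps ->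
  exists c Q : R, [/\ 0 <= Q &
    forall j, `|\sum_(1 <= g < j.+1) totient_ratio (g * a) * totient_ratio (g * b)
                - c * j%:R| <= eps * j%:R + Q].
Proof.
move=> a0 b0 e0.
have := truncnS_gt (2 / eps); move: (Num.truncn _) => t tE.
(* Large enough to exceed a and b, as the tail bound requires, and to make the two tails together at
   most eps. *)
pose y := (a + b + t + 2)%N.
have y0 : (0 < y.-1)%N by rewrite /y; lia.
have yeps : 2 / y.-1%:R <= eps.
  rewrite ler_pdivrMr ?ltr0n // mulrC -ler_pdivrMr // ltW //.
  apply: lt_le_trans tE _; rewrite ler_nat /y; lia.
have [|g|g|c Hc] := @periodic_mean R
  (fun g => trunc_ratio y (g * a) * trunc_ratio y (g * b)) y`!.
- exact: fact_gt0.
- by rewrite !mulnDl ![(y`! * _)%N]mulnC !trunc_ratioD.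
- have /andP[h1 h2] := trunc_ratio01 y (g * a).
  have /andP[h3 h4] := trunc_ratio01 y (g * b).
  by rewrite mulr_ge0 //= mulr_ile1.
exists c, (y`!)%:R; split=> // j.
(* Exceeds every ga and gb in the range, so the product cut at [K] is the full ratio. *)
pose K := (j * (a + b) + y).+1.
set A := \sum_(1 <= g < j.+1) _.
have AB : `|A - \sum_(1 <= g < j.+1) trunc_ratio y (g * a) * trunc_ratio y (g * b)|
    <= eps * j%:R.
  rewrite -sumrB; apply: le_trans (ler_norm_sum _ _ _) _.
  apply: (@le_trans _ _ (\sum_(1 <= g < j.+1)
      (prime_tail y K (g * a) + prime_tail y K (g * b)))); last first.
    have ta : \sum_(1 <= g < j.+1) prime_tail y K (g * a) <= j%:R / y.-1%:R.
      by apply: sum_prime_tail => //; rewrite /y; lia.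
    have tb : \sum_(1 <= g < j.+1) prime_tail y K (g * b) <= j%:R / y.-1%:R.
      by apply: sum_prime_tail => //; rewrite /y; lia.
    rewrite big_split /=; apply: le_trans (lerD ta tb) _.
    by rewrite -mulr2n -[_ *+ 2]mulr_natl mulrCA mulrC ler_wpM2r.
  rewrite big_nat [leRHS]big_nat; apply: ler_sum => g /andP[g1 gj].
  rewrite !(@totient_trunc_ratio K); last 2 first.
  - rewrite muln_gt0 b0 g1 /= /K; nia.
  - rewrite muln_gt0 a0 g1 /= /K; nia.
  have yK : (y <= K)%N by rewrite /K; lia.
  have /andP[h1 h2] := trunc_ratio_tail (g * a) yK.
  have /andP[h3 h4] := trunc_ratio_tail (g * b) yK.
  have /andP[h5 h6] := trunc_ratio01 y (g * a).
  have /andP[h7 h8] := trunc_ratio01 K (g * b).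
  rewrite distrC ger0_norm; nra.
have := ler_normD (A - \sum_(1 <= g < j.+1) trunc_ratio y (g * a) * trunc_ratio y (g * b))
  (\sum_(1 <= g < j.+1) trunc_ratio y (g * a) * trunc_ratio y (g * b) - c * j%:R).
rewrite addrA subrK => /le_trans; apply.
by rewrite lerD.
Qed.

(** * Sums of products of totients: asymptotics and a lower bound on the mean *)

Definition totient_sum (a b k : nat) : R :=
  \sum_(1 <= g < k.+1) (totient (g * a))%:R * (totient (g * b))%:R.

Lemma totient_sumE a b k : (0 < a)%N -> (0 < b)%N ->
  totient_sum a b k = (a * b)%:R *
    \sum_(1 <= g < k.+1) g%:R ^+ 2 * (totient_ratio (g * a) * totient_ratio (g * b)).
Proof.
move=> a0 b0; rewrite mulr_sumr /totient_sum big_nat [RHS]big_nat; apply: eq_bigr => g.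
move=> /andP[g0 _]; rewrite /totient_ratio !natrM; field.
by rewrite !pnatr_eq0 -!lt0n a0 b0 g0.
Qed.

Lemma totient_sum_asymp (a b : nat) (eps : R) : (0 < a)%N -> (0 < b)%N -> 0 < eps ->
  exists c K : R, [/\ 0 <= K &
    forall k, `|totient_sum a b k - c * k%:R ^+ 3| <= eps * k%:R ^+ 3 + K * k%:R ^+ 2].
Proof.
move=> a0 b0 e0; have ab0 : 0 < (a * b)%:R :> R by rewrite ltr0n muln_gt0 a0.
(* The precision is divided by 2ab to offset the factor 2 from summation by parts and the factor ab
   pulled out of the sum. *)
have [|c [Q [Q0 Hc]]] := @totient_ratio_mean a b (eps / (2 * (a * b)%:R)) a0 b0.
  by rewrite divr_gt0 // mulr_gt0.
exists ((a * b)%:R * (c / 3)), ((a * b)%:R * (2 * Q + `|c|)); split=> [|k].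
  by rewrite mulr_ge0 ?addr_ge0 ?mulr_ge0.
rewrite totient_sumE // -mulrA -mulrBr normrM normr_nat.
have e1 : 0 <= eps / (2 * (a * b)%:R) by rewrite divr_ge0 ?mulr_ge0 ?(ltW e0).
have := abel_sqr_mean e1 Q0 Hc k.
rewrite -(ler_pM2l ab0) => /le_trans; apply; rewrite le_eqVlt; apply/orP; left.
by apply/eqP; field; rewrite !pnatr_eq0 -!lt0n a0 b0.
Qed.

(** The prime 2 gives 1/4; the other primes are odd, and 1/(2x+1)^2 <= 1/(4x) - 1/(4(x+1))
    telescopes over x >= 1 to at most 1/4. *)
Lemma sum_prime_inv_sqr (K : nat) : \sum_(0 <= p < K | prime p) (p%:R ^- 2 : R) <= 2^-1.
Proof.
have odd_bound t : \sum_(0 <= p < t.+1.*2.+1 | prime p) (p%:R ^- 2 : R)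
    <= 2^-1 - (4 * t.+1%:R)^-1.
  elim: t => [|t IHt].
    by rewrite big_mkcond unlock /=; lra.
  rewrite (_ : t.+2.*2.+1 = t.+1.*2.+3)%N // big_mkcond 2?big_nat_recr //= -big_mkcond /=.
  have -> : prime t.+1.*2.+2 = false.
    by apply/negP => /even_prime[|]; [lia | rewrite /= odd_double].
  rewrite addr0; apply: (le_trans (lerD IHt (_ : _ <= t.+1.*2.+1%:R ^- 2))).
    by case: (prime _); rewrite // invr_ge0 exprn_ge0.
  have x0 : 0 < t.+1%:R :> R by rewrite ltr0n.
  rewrite -[t.+1.*2.+1%:R]natr1 -muln2 natrM -[t.+2%:R]natr1.
  set x := t.+1%:R in x0 *; rewrite -subr_ge0.
  rewrite (_ : _ - _ = (4 * x * (x + 1) * (2 * x + 1) ^+ 2)^-1).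
    by rewrite invr_ge0 !mulr_ge0 ?exprn_ge0 //; lra.
  by field; lra.
have : (K <= K.+1.*2.+1)%N by lia.
move=> KL; apply: le_trans (_ : _ <= \sum_(0 <= p < K.+1.*2.+1 | prime p) p%:R ^- 2) _.
  rewrite [leRHS](big_cat_nat (n := K)) //= lerDl; apply: sumr_ge0 => p _.
  by rewrite invr_ge0 exprn_ge0.
by apply: le_trans (odd_bound K) _; rewrite gerBl invr_ge0 mulr_ge0.
Qed.

(** From r^2 >= r - 1/4, it suffices that the mean of the ratio is at least 1 minus the sum of
    1/p^2, hence at least 1/2. *)
Lemma totient_ratio_mean_lower (j : nat) :
  j%:R / 4 <= \sum_(1 <= g < j.+1) totient_ratio g * totient_ratio g.
Proof.
have h1 : \sum_(1 <= g < j.+1) (totient_ratio g - 4^-1) <=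
    \sum_(1 <= g < j.+1) totient_ratio g * totient_ratio g.
  by apply: ler_sum => g _; have := sqr_ge0 (totient_ratio g - 2^-1); rewrite expr2; nra.
have h2 : \sum_(1 <= g < j.+1) (1 - prime_tail 0 j.+1 g) <=
    \sum_(1 <= g < j.+1) totient_ratio g.
  rewrite big_nat [leRHS]big_nat; apply: ler_sum => g /andP[g0 gj].
  rewrite (@totient_trunc_ratio j.+1) ?g0 //.
  have := @trunc_ratio_tail 0 j.+1 g isT.
  have -> : trunc_ratio 0 g = 1 by rewrite /trunc_ratio big_geq.
  by move=> /andP[_ h]; lra.
have h3 : \sum_(1 <= g < j.+1) prime_tail 0 j.+1 g <= j%:R / 2.
  rewrite /prime_tail (exchange_big_dep_nat prime) //=; last by move=> g p _ _ _ /andP[].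
  apply: le_trans (ler_wpM2l (ler0n _ j) (sum_prime_inv_sqr j.+1)).
  rewrite mulr_sumr; apply: ler_sum => p pp; have p0 := prime_gt0 pp; rewrite pp /=.
  have -> : \sum_(1 <= g < j.+1 | (p %| g)%N) (p%:R^-1 : R) = (j %/ p)%:R / p%:R.
    by rewrite -count_multiples // mulr_suml; apply: eq_bigr => g _; rewrite mul1r.
  rewrite -exprVn expr2 mulrA ler_wpM2r ?invr_ge0 //.
  by rewrite ler_pdivlMr ?ltr0n // -natrM ler_nat leq_trunc_div.
move: h1 h2; rewrite !sumrB !sumr_const_nat subn1 /= -[4^-1 *+ j]mulr_natl; lra.
Qed.

End TotientMean.

(** * Summation over gcd classes *)

(** The map sending (a, b, g) to (ga, gb), on coprime a and b, is inverted by g = gcd(d, e). Both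
    sides are written as sums over duplicate-free lists with the same elements. *)
Lemma sum_gcd_param (V : nmodType) (f : nat -> nat -> V) n :
  \sum_(1 <= d < n.+1) \sum_(1 <= e < n.+1) f d e =
  \sum_(1 <= a < n.+1) \sum_(1 <= b < n.+1 | coprime a b)
    \sum_(1 <= g < n.+1 | (g * a <= n)%N && (g * b <= n)%N) f (g * a)%N (g * b)%N.
Proof.
pose r := index_iota 1 n.+1.
pose r3 := [seq (a, bg) | a <- r, bg <- [seq (b, g) | b <- r, g <- r]].
pose ok (t : nat * (nat * nat)) :=
  [&& coprime t.1 t.2.1, (t.2.2 * t.1 <= n)%N & (t.2.2 * t.2.1 <= n)%N].
have r3P t : (t \in r3) = [&& t.1 \in r, t.2.1 \in r & t.2.2 \in r].
  case: t => a [b g]; apply/allpairsP/and3P => [[[x [y z]] /= [xr]]|[/= ar br gr]].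
    by move=> /allpairsP[[y' z'] /= [yr zr [-> ->]]] [-> -> ->].
  exists (a, (b, g)); split=> //=; apply/allpairsP; by exists (b, g).
have -> : \sum_(1 <= a < n.+1) \sum_(1 <= b < n.+1 | coprime a b)
    \sum_(1 <= g < n.+1 | (g * a <= n)%N && (g * b <= n)%N) f (g * a)%N (g * b)%N =
    \sum_(t <- [seq (t.2.2 * t.1, t.2.2 * t.2.1)%N | t <- r3 & ok t]) f t.1 t.2.
  rewrite big_map big_filter [RHS]big_mkcond big_allpairs_dep; apply: eq_bigr => a _.
  rewrite big_allpairs_dep [LHS]big_mkcond; apply: eq_bigr => b _ /=.
  rewrite /ok /=; case: (coprime a b) => /=; last by rewrite big1_eq.
  by rewrite -big_mkcond.
transitivity (\sum_(t <- [seq (d, e) | d <- r, e <- r]) f t.1 t.2).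
  by rewrite big_allpairs.
apply: perm_big; apply: uniq_perm.
- by rewrite allpairs_uniq ?iota_uniq // => -[? ?] [? ?].
- rewrite map_inj_in_uniq; first by rewrite filter_uniq // !allpairs_uniq ?iota_uniq //;
    do ?[by move=> -[? ?] [? ?]]; rewrite allpairs_uniq ?iota_uniq // => -[? ?] [? ?].
  move=> [a [b g]] [a' [b' g']]; rewrite !mem_filter !r3P /ok /= !mem_index_iota.
  move=> /andP[/and3P[cab _ _] /and3P[_ _ /andP[g0 _]]].
  move=> /andP[/and3P[cab' _ _] _] [ea eb].
  have gE : g = g'.
    move: (congr2 gcdn ea eb); rewrite -!muln_gcdr.
    by rewrite (eqP cab) (eqP cab') !muln1.
  move: ea eb; rewrite -gE => /eqP; rewrite eqn_pmul2l // => /eqP -> /eqP.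
  by rewrite eqn_pmul2l // => /eqP ->.
move=> [d e]; apply/allpairsP/mapP => [[[d' e'] /= [dr er [-> ->]]]|].
  move: dr er; rewrite !mem_index_iota => /andP[d0 dn] /andP[e0 en].
  have g0 : (0 < gcdn d' e')%N by rewrite gcdn_gt0 d0.
  exists (d' %/ gcdn d' e', (e' %/ gcdn d' e', gcdn d' e'))%N => /=; last first.
    by rewrite ![(gcdn _ _ * _)%N]mulnC !divnK ?dvdn_gcdl ?dvdn_gcdr.
  rewrite mem_filter r3P /ok /= !mem_index_iota ![(gcdn _ _ * _)%N]mulnC.
  rewrite !divnK ?dvdn_gcdl ?dvdn_gcdr // (dn : (d' <= n)%N) (en : (e' <= n)%N).
  have gd := dvdn_leq d0 (dvdn_gcdl d' e'); have ge := dvdn_leq e0 (dvdn_gcdr d' e').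
  have qn m : (m < n.+1)%N -> (m %/ gcdn d' e' < n.+1)%N.
    exact: leq_ltn_trans (leq_div _ _).
  rewrite !divn_gt0 // g0 gd ge !qn // (leq_ltn_trans gd dn) !andbT.
  rewrite /coprime -(eqn_pmul2l g0) muln_gcdr muln1 ![(gcdn _ _ * _)%N]mulnC.
  by rewrite !divnK ?dvdn_gcdl ?dvdn_gcdr.
move=> [[a [b g]]]; rewrite mem_filter r3P /ok /= !mem_index_iota.
move=> /andP[/and3P[_ h1 h2] /and3P[/andP[a0 _] /andP[b0 _] /andP[g0 _]]] [-> ->].
exists (g * a, g * b)%N; rewrite /= !mem_index_iota !muln_gt0 a0 b0 g0 !ltnS h1 h2.
by split.
Qed.

(** * Weights and bounds for the contribution of each coprime pair *)

Section Variance.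
Variable R : realType.
Implicit Types (alpha beta : R).

(** The covariance of ga and gb for coprime a, b, as a function of m = n/g alone: nested floors
    compose and lcm(ga, gb) = gab. *)
Definition miss_weight beta (a b m : nat) : R :=
  beta ^+ (m %/ a + m %/ b - m %/ (a * b)) * (1 - beta ^+ (m %/ (a * b))).

Lemma miss_cov_weight beta n g a b : coprime a b ->
  miss_cov beta n (g * a) (g * b) = miss_weight beta a b (n %/ g).
Proof.
move=> cab; rewrite /miss_cov /miss_weight -muln_lcmr !divnMA.
by rewrite -[lcmn a b]muln1 -(eqP cab) muln_lcm_gcd divnMA.
Qed.

Lemma miss_weight0 beta a b m : (m < a * b)%N -> miss_weight beta a b m = 0.
Proof. by move=> mab; rewrite /miss_weight (divn_small mab) expr0 subrr mulr0. Qed.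

Lemma pow01 beta k : 0 <= beta <= 1 -> 0 <= beta ^+ k <= 1.
Proof. by move=> /andP[b0 b1]; rewrite exprn_ge0 // exprn_ile1. Qed.

Lemma pow_cov01 beta j k : 0 <= beta <= 1 ->
  [&& 0 <= beta ^+ j * (1 - beta ^+ k),
    beta ^+ j * (1 - beta ^+ k) <= 1 - beta ^+ k & 1 - beta ^+ k <= 1].
Proof.
move=> b01; have /andP[x0 x1] := pow01 j b01; have /andP[y0 y1] := pow01 k b01.
by rewrite mulr_ge0 ?subr_ge0 //= ler_piMl ?subr_ge0 //= gerBl.
Qed.

Lemma miss_weight01 beta a b m : 0 <= beta <= 1 -> 0 <= miss_weight beta a b m <= 1.
Proof.
move=> b01.
have /and3P[-> h1 h2] :=
  pow_cov01 (m %/ a + m %/ b - m %/ (a * b)) (m %/ (a * b)) b01.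
exact: le_trans h1 h2.
Qed.

Lemma miss_cov01 beta n d e : 0 <= beta <= 1 -> 0 <= miss_cov beta n d e <= 1.
Proof.
move=> b01.
have /and3P[-> h1 h2] :=
  pow_cov01 (n %/ d + n %/ e - n %/ lcmn d e) (n %/ lcmn d e) b01.
exact: le_trans h1 h2.
Qed.

Lemma one_sub_pow_le alpha k : 0 <= alpha <= 1 ->
  1 - (1 - alpha) ^+ k <= alpha * k%:R.
Proof.
move=> /andP[a0 a1]; elim: k => [|k IHk]; first by rewrite expr0 subrr mulr0.
have /andP[x0 x1] : 0 <= (1 - alpha) ^+ k <= 1 by apply: pow01; lra.
by rewrite exprS -natr1; nra.
Qed.

(* The contribution of the pairs (d, e) with d / gcd(d, e) = a and
   e / gcd(d, e) = b. *)
Definition pair_sum beta (a b n : nat) : R :=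
  \sum_(1 <= g < n.+1)
    (totient (g * a))%:R * (totient (g * b))%:R * miss_weight beta a b (n %/ g).

(* The index d = 1, absent from the variance, is included here. *)
Definition full_var beta (n : nat) : R :=
  \sum_(1 <= d < n.+1) \sum_(1 <= e < n.+1)
    (totient d)%:R * (totient e)%:R * miss_cov beta n d e.

Lemma full_var_pair_sum beta n :
  full_var beta n =
  \sum_(1 <= a < n.+1) \sum_(1 <= b < n.+1 | coprime a b) pair_sum beta a b n.
Proof.
rewrite /full_var sum_gcd_param big_nat [RHS]big_nat; apply: eq_bigr => a /andP[a0 _].
rewrite big_nat_cond [RHS]big_nat_cond; apply: eq_bigr => b /andP[/andP[b0 _] cab].
rewrite /pair_sum big_mkcond big_nat [RHS]big_nat; apply: eq_bigr => g /andP[g0 _].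
rewrite miss_cov_weight //; case: ifP => // /negbT gab.
rewrite miss_weight0 ?mulr0 // ltn_divLR // mulnC.
move: gab; rewrite negb_and -!ltnNge => /orP[] h; apply: (leq_trans h); nia.
Qed.

Lemma totient_leq k : (totient k <= k)%N.
Proof.
case: k => // k; rewrite -(ler_nat R).
have /andP[_] := totient_ratio01 R k.+1.
by rewrite /totient_ratio ler_pdivrMr ?ltr0n // mul1r.
Qed.

(** The factor 1 - beta^k is kept in the bound: estimating it by 1 gives a bound uniform in alpha,
    estimating it by alpha k gives the bound linear in alpha. *)
Lemma pair_term_le beta a b n g : 0 <= beta <= 1 -> (0 < a)%N -> (0 < b)%N -> (0 < g)%N ->
  0 <= (totient (g * a))%:R * (totient (g * b))%:R * miss_weight beta a b (n %/ g)
    <= (if (g <= n %/ (a * b))%N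
        then (g * a)%:R * (g * b)%:R * (1 - beta ^+ (n %/ g %/ (a * b)))
        else 0).
Proof.
move=> b01 a0 b0 g0; have /andP[w0 w1] := miss_weight01 a b (n %/ g) b01.
apply/andP; split; first by apply: mulr_ge0 => //; apply: mulr_ge0.
have [h|h] := leqP g (n %/ (a * b)); last first.
  rewrite miss_weight0 ?mulr0 // ltn_divLR // mulnC -ltn_divLR ?muln_gt0 ?a0 //.
apply: ler_pM => //; first exact: mulr_ge0.
  by apply: ler_pM; rewrite ?ler_nat ?totient_leq.
by case/and3P: (pow_cov01 (n %/ g %/ a + n %/ g %/ b - n %/ g %/ (a * b))
  (n %/ g %/ (a * b)) b01).
Qed.

Lemma sum_if_leq_le (f : nat -> R) (x : R) (k n : nat) : 0 <= x ->
  (forall g, (0 < g <= k)%N -> f g <= x) ->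
  \sum_(1 <= g < n.+1) (if (g <= k)%N then f g else 0) <= k%:R * x.
Proof.
move=> x0 fx; elim: n => [|n IHn]; first by rewrite big_geq // mulr_ge0.
have [nk|kn] := leqP n.+1 k; last by rewrite sum1S leqNgt kn addr0.
apply: le_trans (_ : _ <= n.+1%:R * x) _; last by rewrite ler_wpM2r // ler_nat.
elim: n {IHn} nk => [|n IHn] nk.
  by rewrite big_nat1 nk mul1r fx ?nk.
by rewrite sum1S nk -[n.+2%:R]natr1 mulrDl mul1r lerD ?IHn 1?ltnW // fx // nk.
Qed.

Lemma div_natr_le (n c : nat) : (0 < c)%N -> (n %/ c)%:R <= n%:R / c%:R :> R.
Proof. by move=> c0; rewrite ler_pdivlMr ?ltr0n // -natrM ler_nat leq_trunc_div. Qed.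

Lemma pair_sum_ge0 beta a b n : 0 <= beta <= 1 -> (0 < a)%N -> (0 < b)%N ->
  0 <= pair_sum beta a b n.
Proof.
move=> b01 a0 b0; rewrite /pair_sum big_nat; apply: sumr_ge0 => g /andP[g0 _].
by case/andP: (pair_term_le n b01 a0 b0 g0).
Qed.

(** At most n/(ab) values of g count, each contributing at most g^2 ab. The result is summable over
    a and b, uniformly in [beta]. *)
Lemma pair_sum_le beta a b n : 0 <= beta <= 1 -> (0 < a)%N -> (0 < b)%N ->
  pair_sum beta a b n <= n%:R ^+ 3 * (a%:R ^- 2 * b%:R ^- 2).
Proof.
move=> b01 a0 b0; set k := (n %/ (a * b))%N.
have ab0 : 0 < (a * b)%:R :> R by rewrite ltr0n muln_gt0 a0.
apply: le_trans (_ : _ <= k%:R * (k%:R ^+ 2 * (a * b)%:R)) _.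
  apply: le_trans (_ : _ <= \sum_(1 <= g < n.+1)
     (if (g <= k)%N then (g * a)%:R * (g * b)%:R else 0)) _.
    rewrite /pair_sum big_nat [leRHS]big_nat; apply: ler_sum => g /andP[g0 _].
    have /andP[_ /le_trans] := pair_term_le n b01 a0 b0 g0; apply.
    rewrite -/k; case: ifP => // _; rewrite ler_piMr ?mulr_ge0 // gerBl.
    by case/andP: (pow01 (n %/ g %/ (a * b)) b01).
  apply: sum_if_leq_le => [|g /andP[_ gk]]; first by rewrite mulr_ge0 ?exprn_ge0.
  by rewrite -!natrM -natrX -natrM ler_nat mulnACA -mulnn !leq_mul.
rewrite mulrA -exprS.
have h : k%:R ^+ 3 <= (n%:R / (a * b)%:R) ^+ 3 :> R.
  by rewrite lerXn2r ?nnegrE ?div_natr_le ?divr_ge0 // muln_gt0 a0.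
apply: le_trans (ler_wpM2r (ltW ab0) h) _.
rewrite le_eqVlt; apply/orP; left; apply/eqP; rewrite natrM; field.
by rewrite !pnatr_eq0 -!lt0n a0 b0.
Qed.

(** Here the weight is at most alpha n/(gab), so a term is at most alpha n g, with g and the number
    of terms both at most n/(ab). *)
Lemma pair_sum_le_alpha alpha a b n : 0 <= alpha <= 1 -> (0 < a)%N -> (0 < b)%N ->
  pair_sum (1 - alpha) a b n <= alpha * n%:R ^+ 3 * (a%:R ^- 2 * b%:R ^- 2).
Proof.
move=> a01 a0 b0; set k := (n %/ (a * b))%N.
have b01 : 0 <= 1 - alpha <= 1 by lra.
have /andP[al0 al1] := a01.
have ab0 : 0 < (a * b)%:R :> R by rewrite ltr0n muln_gt0 a0.
apply: le_trans (_ : _ <= k%:R * (alpha * n%:R * k%:R)) _.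
  apply: le_trans (_ : _ <= \sum_(1 <= g < n.+1)
     (if (g <= k)%N then alpha * n%:R * g%:R else 0)) _.
    rewrite /pair_sum big_nat [leRHS]big_nat; apply: ler_sum => g /andP[g0 _].
    have /andP[_ /le_trans] := pair_term_le n b01 a0 b0 g0; apply.
    rewrite -/k; case: ifP => // _.
    apply: le_trans (ler_wpM2l _ (one_sub_pow_le _ a01)) _; first by rewrite mulr_ge0.
    rewrite -divnMA.
    have h : (n %/ (g * (a * b)))%:R <= n%:R / (g * (a * b))%:R :> R.
      by rewrite div_natr_le // !muln_gt0 g0 a0.
    apply: le_trans (ler_wpM2l _ (ler_wpM2l al0 h)) _; first by rewrite mulr_ge0.
    rewrite le_eqVlt; apply/orP; left; apply/eqP; rewrite !natrM; field.
    by rewrite !pnatr_eq0 -!lt0n a0 b0 g0.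
  apply: sum_if_leq_le => [|g /andP[_ gk]]; first by rewrite !mulr_ge0.
  by rewrite ler_wpM2l ?mulr_ge0 // ler_nat.
have h : k%:R <= n%:R / (a * b)%:R :> R by rewrite div_natr_le // muln_gt0 a0.
have h2 : k%:R * k%:R <= (n%:R / (a * b)%:R) * (n%:R / (a * b)%:R) :> R by rewrite ler_pM.
have -> : k%:R * (alpha * n%:R * k%:R) = alpha * n%:R * (k%:R * k%:R) by ring.
apply: le_trans (ler_wpM2l _ h2) _; first by rewrite mulr_ge0.
rewrite le_eqVlt; apply/orP; left; apply/eqP; rewrite natrM; field.
by rewrite !pnatr_eq0 -!lt0n a0 b0.
Qed.

(** The difference is the row d = 1 and the column e = 1, each of at most n terms bounded by n. *)
Lemma varX_full_var alpha n : 0 <= alpha <= 1 ->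
  0 <= full_var (1 - alpha) n - varX n alpha <= 2 * n%:R ^+ 2.
Proof.
move=> a01; have b01 : 0 <= 1 - alpha <= 1 by lra.
set b := 1 - alpha in b01 *; rewrite varX_miss_cov -/b /full_var.
pose f d e : R := (totient d)%:R * (totient e)%:R * miss_cov b n d e.
have f0 d e : 0 <= f d e.
  have /andP[m0 _] := miss_cov01 n d e b01.
  by apply: mulr_ge0 => //; apply: mulr_ge0.
have f1 d e : f d e <= d%:R * e%:R.
  rewrite -[leRHS]mulr1 /f; have /andP[m0 m1] := miss_cov01 n d e b01.
  apply: ler_pM => //; first exact: mulr_ge0.
  by apply: ler_pM; rewrite ?ler_nat ?totient_leq.
have [n0|n0] := posnP n; first by rewrite n0 !big_geq // subrr lexx mulr_ge0 ?exprn_ge0.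
have -> : \sum_(1 <= d < n.+1) \sum_(1 <= e < n.+1) f d e -
    \sum_(2 <= d < n.+1) \sum_(2 <= e < n.+1) f d e =
    \sum_(1 <= e < n.+1) f 1%N e + \sum_(2 <= d < n.+1) f d 1%N.
  rewrite big_ltn ?ltnS // -addrA -sumrB; congr (_ + _).
  by apply: eq_bigr => d _; rewrite big_ltn ?ltnS // addrK.
rewrite addr_ge0 ?sumr_ge0 //= (natrD _ 1 1) mulrDl mul1r expr2.
have sn m : \sum_(m.+1 <= e < n.+1) (n%:R : R) <= n%:R * n%:R.
  by rewrite sumr_const_nat -[n%:R *+ _]mulr_natl ler_wpM2r // ler_nat; lia.
apply: lerD; [apply: le_trans (sn 0%N)|apply: le_trans (sn 1%N)];
  rewrite big_nat [leRHS]big_nat; apply: ler_sum => e /andP[_ en];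
  apply: le_trans (f1 _ _) _.
  by rewrite mul1r ler_nat.
by rewrite mulr1 ler_nat.
Qed.

Lemma full_var_le alpha n : 0 <= alpha <= 1 ->
  full_var (1 - alpha) n <= 4 * alpha * n%:R ^+ 3.
Proof.
move=> a01; have /andP[al0 _] := a01; rewrite full_var_pair_sum.
apply: le_trans (_ : _ <= \sum_(1 <= a < n.+1) \sum_(1 <= b < n.+1)
    alpha * n%:R ^+ 3 * (a%:R ^- 2 * b%:R ^- 2)) _.
  rewrite big_nat [leRHS]big_nat; apply: ler_sum => a /andP[a0 _].
  rewrite big_mkcond big_nat [leRHS]big_nat; apply: ler_sum => b /andP[b0 _].
  case: ifP => _; first exact: pair_sum_le_alpha.
  by rewrite !mulr_ge0 ?exprn_ge0 ?invr_ge0 ?exprn_ge0.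
under eq_bigr do rewrite -mulr_sumr -mulr_sumr.
(* The 4 is the square of the bound 2 on the sum of inverse squares. *)
have -> : 4 * alpha * n%:R ^+ 3 = alpha * n%:R ^+ 3 * 4 by ring.
rewrite -mulr_sumr -mulr_suml ler_wpM2l ?mulr_ge0 ?exprn_ge0 //.
have s0 : 0 <= \sum_(1 <= a < n.+1) (a%:R ^- 2 : R).
  by apply: sumr_ge0 => a _; rewrite invr_ge0 exprn_ge0.
have := sum_inv_sqr R n.+1; nra.
Qed.

End Variance.

(** * Uniform convergence *)

Section Limit.
Variable R : realType.

(* Uniform convergence on (0, 1), phrased without the limit: for every eps the
   sequence is eventually within eps of some function. *)
Definition unif_approx (f : nat -> R -> R) : Prop :=
  forall eps : R, 0 < eps -> exists (h : R -> R) (N : nat),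
    forall n alpha, (N <= n)%N -> 0 < alpha < 1 -> `|f n alpha - h alpha| <= eps.

Lemma unif_approx_lim f : unif_approx f -> exists v : R -> R,
  forall eps, 0 < eps -> exists N : nat,
    forall n alpha, (N <= n)%N -> 0 < alpha < 1 -> `|f n alpha - v alpha| <= eps.
Proof.
move=> fU; pose E alpha : set R :=
  fun x => exists N : nat, forall n, (N <= n)%N -> x <= f n alpha.
(* The limit is taken as a lower limit: the supremum of the eventual lower bounds of the sequence.
   It lies within eps/2 of every eps/2-approximant. *)
exists (fun alpha => sup (E alpha)) => eps e0.
have [|h [N hN]] := fU (eps / 2); first by rewrite divr_gt0.
exists N => n alpha Nn a01.
have hn m : (N <= m)%N -> h alpha - eps / 2 <= f m alpha <= h alpha + eps / 2.
  by move=> Nm; have := hN m alpha Nm a01; rewrite ler_norml; lra.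
have Elow : E alpha (h alpha - eps / 2).
  by exists N => m /hn /andP[].
have Eup : ubound (E alpha) (h alpha + eps / 2).
  move=> x [N' xN']; apply: (le_trans (xN' _ (leq_maxl N' N))).
  by have /andP[] := hn _ (leq_maxr N' N).
have h1 : sup (E alpha) <= h alpha + eps / 2.
  by apply: ge_sup Eup; exists (h alpha - eps / 2).
have h2 : h alpha - eps / 2 <= sup (E alpha).
  by apply: ub_le_sup Elow; exists (h alpha + eps / 2).
by have /andP[] := hn n Nn; rewrite ler_norml; lra.
Qed.

Lemma unif_approx_close f :
  (forall eps, 0 < eps -> exists g, unif_approx g /\ exists N : nat,
     forall n alpha, (N <= n)%N -> 0 < alpha < 1 -> `|f n alpha - g n alpha| <= eps) ->
  unif_approx f.
Proof.
move=> fg eps e0; have e2 : 0 < eps / 2 by rewrite divr_gt0.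
have [g [gU [N fN]]] := fg _ e2; have [h [N' hN']] := gU _ e2.
exists h, (maxn N N') => n alpha; rewrite geq_max => /andP[Nn N'n] a01.
have := fN n alpha Nn a01; have := hN' n alpha N'n a01.
by rewrite !ler_norml; lra.
Qed.

Lemma unif_approxD f g : unif_approx f -> unif_approx g ->
  unif_approx (fun n alpha => f n alpha + g n alpha).
Proof.
move=> fU gU eps e0; have e2 : 0 < eps / 2 by rewrite divr_gt0.
have [h [N hN]] := fU _ e2; have [h' [N' hN']] := gU _ e2.
exists (fun alpha => h alpha + h' alpha), (maxn N N') => n alpha.
rewrite geq_max => /andP[Nn N'n] a01.
have := hN n alpha Nn a01; have := hN' n alpha N'n a01.
by rewrite !ler_norml; lra.
Qed.

Lemma unif_approx_sum (r : seq nat) (P : pred nat) (f : nat -> nat -> R -> R) :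
  (forall i, i \in r -> unif_approx (f i)) ->
  unif_approx (fun n alpha => \sum_(i <- r | P i) f i n alpha).
Proof.
elim: r => [|i r IHr] fU.
  move=> eps e0; exists (fun=> 0), 0%N => n alpha _ _.
  by rewrite big_nil subrr normr0 ltW.
have rU : unif_approx (fun n alpha => \sum_(i <- r | P i) f i n alpha).
  by apply: IHr => j jr; apply: fU; rewrite inE jr orbT.
have [Pi|nPi] := boolP (P i); last first.
  move=> eps /rU[h [N hN]]; exists h, N => n alpha.
  by rewrite big_cons (negbTE nPi); apply: hN.
have iU : unif_approx (f i) by apply: fU; rewrite inE eqxx.
move=> eps /(unif_approxD iU rU)[h [N hN]]; exists h, N => n alpha.
by rewrite big_cons Pi; apply: hN.
Qed.

(** Only [w] depends on alpha, and being at most 1 it cannot enlarge the error, so the threshold on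
    n is the one for [u]. *)
Lemma unif_approx_weight (u : nat -> R) (w : R -> R) :
  (forall eps, 0 < eps -> exists (c : R) (N : nat),
     forall n, (N <= n)%N -> `|u n - c| <= eps) ->
  (forall alpha, 0 < alpha < 1 -> 0 <= w alpha <= 1) ->
  unif_approx (fun n alpha => w alpha * u n).
Proof.
move=> uC w01 eps e0; have [c [N cN]] := uC _ e0.
exists (fun alpha => w alpha * c), N => n alpha Nn a01.
have /andP[w0 w1] := w01 _ a01.
rewrite -mulrBr normrM (ger0_norm w0); apply: le_trans (cN n Nn).
by rewrite ler_piMl.
Qed.

Lemma archi_bound (x : R) : exists N : nat, (0 < N)%N /\ forall n, (N <= n)%N -> x <= n%:R.
Proof.
exists (Num.truncn x).+1; split=> // n Nn; apply: le_trans (ltW (truncnS_gt x)) _.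
by rewrite ler_nat.
Qed.

(** Rounding n/m down moves the quotient by n by at most 1/n, and its cube by at most 3/n. *)
Lemma totient_sum_div_asymp (a b m : nat) (eps : R) :
  (0 < a)%N -> (0 < b)%N -> (0 < m)%N -> 0 < eps ->
  exists (c : R) (N : nat), forall n, (N <= n)%N ->
    `|totient_sum R a b (n %/ m) / n%:R ^+ 3 - c| <= eps.
Proof.
move=> a0 b0 m0 e0; have e2 : 0 < eps / 2 by rewrite divr_gt0.
have [c [K [K0 HS]]] := totient_sum_asymp a0 b0 e2.
exists (c / m%:R ^+ 3).
have [N [N0 HN]] := archi_bound (2 * (K + 3 * `|c|) / eps).
exists N => n Nn; have n0 : 0 < n%:R :> R by rewrite ltr0n (leq_trans N0 Nn).
have mR : 0 < m%:R :> R by rewrite ltr0n.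
set k := (n %/ m)%N; pose x : R := k%:R / n%:R; pose z : R := m%:R^-1.
have z0 : 0 < z by rewrite invr_gt0.
have z1 : z <= 1 by rewrite invf_le1 ?ler1n.
have x0 : 0 <= x by rewrite divr_ge0.
have xz : x <= z.
  rewrite /x /z ler_pdivrMr // mulrC ler_pdivlMr // -natrM ler_nat.
  exact: leq_trunc_div.
have zx : z - x <= n%:R^-1.
  rewrite /x /z -(ler_pM2r n0) mulrBl mulVf ?gt_eqF // divfK ?gt_eqF //.
  rewrite lerBlDr mulrC ler_pdivrMr // -[1]/(1%:R) -natrD -natrM ler_nat.
  by rewrite add1n ltnW // ltn_ceil.
have n1 : 0 < n%:R^-1 :> R by rewrite invr_gt0.
have n3 : 0 < n%:R ^+ 3 :> R by rewrite exprn_gt0.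
have x3 : x ^+ 3 <= 1 by rewrite exprn_ile1 //; lra.
have zx3 : `|x ^+ 3 - z ^+ 3| <= 3 * n%:R^-1.
  rewrite distrC ger0_norm; last by rewrite subr_ge0 lerXn2r ?nnegrE ?(ltW z0).
  have -> : z ^+ 3 - x ^+ 3 = (z - x) * (z ^+ 2 + z * x + x ^+ 2) by ring.
  have h : z ^+ 2 + z * x + x ^+ 2 <= 3 by nra.
  have h' : 0 <= z ^+ 2 + z * x + x ^+ 2 by nra.
  by rewrite mulrC; apply: ler_pM => //; lra.
have S1 : `|totient_sum R a b k / n%:R ^+ 3 - c * x ^+ 3| <= eps / 2 + K * n%:R^-1.
  have -> : totient_sum R a b k / n%:R ^+ 3 - c * x ^+ 3 =
      (totient_sum R a b k - c * k%:R ^+ 3) / n%:R ^+ 3.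
    by rewrite /x; field; rewrite gt_eqF.
  rewrite normrM [X in _ * X]ger0_norm ?invr_ge0 ?(ltW n3) // ler_pdivrMr //.
  apply: le_trans (HS k) _; rewrite mulrDl.
  have kn : k%:R <= n%:R :> R by rewrite ler_nat leq_div.
  apply: lerD; first by rewrite ler_wpM2l ?(ltW e2) // lerXn2r ?nnegrE.
  rewrite -mulrA ler_wpM2l // [n%:R ^+ 3]exprS mulKf ?gt_eqF //.
  by rewrite lerXn2r ?nnegrE.
have cE : c / m%:R ^+ 3 = c * z ^+ 3 by rewrite /z exprVn.
have := HN n Nn; rewrite ler_pdivrMr // => HNn.
have S2 : `|c * x ^+ 3 - c * z ^+ 3| <= `|c| * (3 * n%:R^-1).
  by rewrite -mulrBr normrM ler_wpM2l.
have S3 : (K + 3 * `|c|) * n%:R^-1 <= eps / 2.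
  by rewrite ler_pdivrMr //; lra.
rewrite cE; have -> : totient_sum R a b k / n%:R ^+ 3 - c * z ^+ 3 =
  (totient_sum R a b k / n%:R ^+ 3 - c * x ^+ 3) + (c * x ^+ 3 - c * z ^+ 3) by ring.
apply: le_trans (ler_normD _ _) _; apply: le_trans (lerD S1 S2) _.
by move: S3; rewrite mulrDl; lra.
Qed.

(** n/g rounds down to m exactly when n/(m+1) < g <= n/m. *)
Lemma totient_sum_fiber (a b m n : nat) : (0 < m)%N ->
  \sum_(1 <= g < n.+1 | (n %/ g)%N == m) (totient (g * a))%:R * (totient (g * b))%:R =
  totient_sum R a b (n %/ m) - totient_sum R a b (n %/ m.+1).
Proof.
move=> m0; have SE k : (k <= n)%N -> totient_sum R a b k = \sum_(1 <= g < n.+1)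
    (if (g <= k)%N then (totient (g * a))%:R * (totient (g * b))%:R else 0).
  move=> kn; rewrite -big_mkcond /= /totient_sum (@big_nat_widen _ _ _ _ k.+1 n.+1) //.
rewrite !SE ?leq_div // -sumrB big_mkcond big_nat [RHS]big_nat.
apply: eq_bigr => g /andP[g0 _].
rewrite !leq_divRL // ![(g * _.+1)%N]mulnC ![(g * m)%N]mulnC -!leq_divRL //.
by case: (ltngtP m (n %/ g)%N) => _; rewrite ?subrr ?subr0.
Qed.

Lemma unif_approx_pair_sum (a b : nat) : (0 < a)%N -> (0 < b)%N ->
  unif_approx (fun n alpha => pair_sum (1 - alpha) a b n / n%:R ^+ 3).
Proof.
move=> a0 b0; apply: unif_approx_close => eps e0.
(* Only the values m = n/g up to [M] are kept. The dropped g are at most n/M, with terms at most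
   n^2, so the loss is at most n^3/M. *)
have [M [M0 HM]] := archi_bound eps^-1.
exists (fun n alpha => \sum_(1 <= m < M.+1) miss_weight (1 - alpha) a b m *
  (totient_sum R a b (n %/ m) / n%:R ^+ 3 - totient_sum R a b (n %/ m.+1) / n%:R ^+ 3)).
split.
  apply: unif_approx_sum => m; rewrite mem_index_iota => /andP[m0 _].
  apply: unif_approx_weight => [e e1|alpha a01]; last by apply: miss_weight01; lra.
  have e2 : 0 < e / 2 by rewrite divr_gt0.
  have [c [N HN]] := totient_sum_div_asymp a0 b0 m0 e2.
  have [c' [N' HN']] := totient_sum_div_asymp a0 b0 (ltn0Sn m) e2.
  exists (c - c'), (maxn N N') => n; rewrite geq_max => /andP[Nn N'n].
  by have := HN n Nn; have := HN' n N'n; rewrite !ler_norml; lra.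
exists 1%N => n alpha n1 a01; have b01 : 0 <= 1 - alpha <= 1 by lra.
have n0 : 0 < n%:R :> R by rewrite ltr0n.
have n3 : 0 < n%:R ^+ 3 :> R by rewrite exprn_gt0.
pose t g := (totient (g * a))%:R * (totient (g * b))%:R *
  miss_weight (1 - alpha) a b (n %/ g).
have -> : \sum_(1 <= m < M.+1) miss_weight (1 - alpha) a b m *
  (totient_sum R a b (n %/ m) / n%:R ^+ 3 - totient_sum R a b (n %/ m.+1) / n%:R ^+ 3)
  = (\sum_(1 <= g < n.+1 | (n %/ g <= M)%N) t g) / n%:R ^+ 3.
  (* The kept terms are grouped by the value m, on which the weight is constant. *)
  rewrite [in RHS]mulr_suml.
  transitivity (\sum_(1 <= m < M.+1) \sum_(1 <= g < n.+1 | (n %/ g)%N == m)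
    t g / n%:R ^+ 3).
    rewrite big_nat [RHS]big_nat; apply: eq_bigr => m /andP[m0 _].
    rewrite -mulrBl -totient_sum_fiber // !mulr_suml mulr_sumr.
    by apply: eq_bigr => g /eqP <-; rewrite /t; ring.
  rewrite (exchange_big_dep_nat xpredT) //= [RHS]big_mkcond /=.
  rewrite big_nat [RHS]big_nat; apply: eq_bigr => g /andP[g0 gn].
  have q0 : (0 < n %/ g)%N by rewrite divn_gt0.
  case: ifP => gM.
    rewrite big_mkcond (bigD1_seq (n %/ g)%N) ?iota_uniq ?mem_index_iota ?q0 //=.
    rewrite eqxx big1 ?addr0 // => m /negbTE mg; by rewrite eq_sym mg.
  rewrite big_nat_cond big_pred0 // => m; apply/negbTE.
  by apply/andP => -[/andP[_ mM] /eqP mE]; move: gM; rewrite mE -ltnS mM.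
rewrite -mulrBl normrM [X in _ * X]ger0_norm ?invr_ge0 ?(ltW n3) // ler_pdivrMr //.
have -> : pair_sum (1 - alpha) a b n - \sum_(1 <= g < n.+1 | (n %/ g <= M)%N) t g =
  \sum_(1 <= g < n.+1) (if (n %/ g <= M)%N then 0 else t g).
  rewrite /pair_sum [X in _ - X]big_mkcond /= -sumrB; apply: eq_bigr => g _.
  by case: ifP; rewrite ?subrr ?subr0.
have t0 g : (0 < g)%N -> 0 <= t g <= n%:R ^+ 2.
  move=> g0; have /andP[-> h] := pair_term_le n b01 a0 b0 g0; apply: le_trans h _.
  have [gk|_] := leqP g (n %/ (a * b)); last by rewrite exprn_ge0.
  have gab : (g * (a * b) <= n)%N by rewrite -leq_divRL // muln_gt0 a0.
  have /andP[y0 y1] := pow01 (n %/ g %/ (a * b)) b01.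
  rewrite -[leRHS]mulr1 ler_pM ?mulr_ge0 ?subr_ge0 // ?gerBl // expr2.
  by rewrite ler_pM // ler_nat (leq_trans _ gab) // leq_mul // ?leq_pmulr ?leq_pmull.
rewrite ger0_norm; last first.
  rewrite big_nat; apply: sumr_ge0 => g /andP[g0 _].
  by case: ifP => // _; case/andP: (t0 g g0).
apply: le_trans (_ : _ <= (n %/ M)%:R * n%:R ^+ 2) _.
  apply: le_trans (_ : _ <= \sum_(1 <= g < n.+1)
      (if (g <= n %/ M)%N then n%:R ^+ 2 else 0)) _; last first.
    by apply: sum_if_leq_le => // ; rewrite exprn_ge0.
  rewrite big_nat [leRHS]big_nat; apply: ler_sum => g /andP[g0 _].
  have /andP[tg0 tg] := t0 g g0.
  have [_|gM] := leqP (n %/ g) M; first by case: ifP => // _; rewrite exprn_ge0.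
  by rewrite leq_divRL // mulnC -leq_divRL // (ltnW gM).
have nM : (n %/ M)%:R <= n%:R / M%:R :> R by apply: div_natr_le.
apply: le_trans (ler_wpM2r _ nM) _; first by rewrite exprn_ge0.
have -> : n%:R / M%:R * n%:R ^+ 2 = M%:R^-1 * n%:R ^+ 3 :> R by ring.
rewrite ler_wpM2r ?(ltW n3) // invf_ple ?posrE ?ltr0n //.
exact: HM.
Qed.

Lemma unif_approx_full_var :
  unif_approx (fun n alpha => full_var (1 - alpha) n / n%:R ^+ 3).
Proof.
apply: unif_approx_close => eps e0.
(* Pairs with a > T or b > T are dropped. They form two rectangles, each of total at most 2/T: a
   full sum at most 2 times a tail at most 1/T. *)
have [T [T0 HT]] := archi_bound (4 / eps).
exists (fun n alpha => \sum_(1 <= a < T.+1) \sum_(1 <= b < T.+1 | coprime a b)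
  pair_sum (1 - alpha) a b n / n%:R ^+ 3); split.
  apply: unif_approx_sum => a; rewrite mem_index_iota => /andP[a0 _].
  apply: unif_approx_sum => b; rewrite mem_index_iota => /andP[b0 _].
  exact: unif_approx_pair_sum.
exists T => n alpha Tn a01; have b01 : 0 <= 1 - alpha <= 1 by lra.
have n0 : 0 < n%:R :> R by rewrite ltr0n (leq_trans T0).
have n3 : 0 < n%:R ^+ 3 :> R by rewrite exprn_gt0.
pose t a b := pair_sum (1 - alpha) a b n / n%:R ^+ 3.
have t01 a b : (0 < a)%N -> (0 < b)%N -> 0 <= t a b <= a%:R ^- 2 * b%:R ^- 2.
  move=> a0 b0; rewrite /t divr_ge0 ?pair_sum_ge0 ?(ltW n3) //=.
  by rewrite ler_pdivrMr // mulrC pair_sum_le.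
have -> : full_var (1 - alpha) n / n%:R ^+ 3 =
    \sum_(1 <= a < n.+1) \sum_(1 <= b < n.+1 | coprime a b) t a b.
  rewrite full_var_pair_sum mulr_suml; apply: eq_bigr => a _.
  by rewrite mulr_suml.
have -> : \sum_(1 <= a < n.+1) \sum_(1 <= b < n.+1 | coprime a b) t a b -
    \sum_(1 <= a < T.+1) \sum_(1 <= b < T.+1 | coprime a b) t a b =
    \sum_(1 <= a < T.+1) \sum_(T.+1 <= b < n.+1 | coprime a b) t a b +
    \sum_(T.+1 <= a < n.+1) \sum_(1 <= b < n.+1 | coprime a b) t a b.
  rewrite [X in X - _](@big_cat_nat _ _ _ T.+1) //= addrAC -sumrB; congr (_ + _).
  apply: eq_bigr => a _.
  by rewrite [X in X - _](@big_cat_nat _ _ _ T.+1) //= addrAC subrr add0r.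
have dom (m m' : nat) : (0 < m)%N -> (0 < m')%N ->
    0 <= \sum_(m <= a < n.+1) \sum_(m' <= b < n.+1 | coprime a b) t a b <=
    (\sum_(m <= a < n.+1) a%:R ^- 2) * (\sum_(m' <= b < n.+1) b%:R ^- 2).
  move=> m0 m'0; apply/andP; split.
    rewrite big_nat; apply: sumr_ge0 => a /andP[ma _]; rewrite big_nat_cond.
    apply: sumr_ge0 => b /andP[/andP[mb _] _].
    by case/andP: (t01 a b (leq_trans m0 ma) (leq_trans m'0 mb)).
  rewrite mulr_suml big_nat [leRHS]big_nat; apply: ler_sum => a /andP[ma _].
  rewrite mulr_sumr big_mkcond big_nat [leRHS]big_nat; apply: ler_sum => b /andP[mb _].
  have /andP[h1 h2] := t01 a b (leq_trans m0 ma) (leq_trans m'0 mb).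
  by case: ifP => // _; apply: le_trans h1 h2.
have pos m : 0 <= \sum_(m <= a < n.+1) (a%:R ^- 2 : R).
  by apply: sumr_ge0 => a _; rewrite invr_ge0 exprn_ge0.
have tail := @sum_inv_sqr_tail R T n.+1 T0; have full := sum_inv_sqr R n.+1.
have /andP[A0 A1] := dom T.+1 1%N isT isT.
have B : 0 <= \sum_(1 <= a < T.+1) \sum_(T.+1 <= b < n.+1 | coprime a b) t a b <=
    (\sum_(1 <= a < n.+1) a%:R ^- 2) * (\sum_(T.+1 <= b < n.+1) b%:R ^- 2).
  have /andP[_ B1] := dom 1%N T.+1 isT isT.
  have /andP[B3 _] := dom T.+1 T.+1 isT isT.
  apply/andP; split.
    rewrite big_nat; apply: sumr_ge0 => a /andP[ma _]; rewrite big_nat_cond.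
    apply: sumr_ge0 => b /andP[/andP[mb _] _].
    by case/andP: (t01 a b ma (leq_trans (ltn0Sn T) mb)).
  apply: le_trans B1; rewrite [leRHS](@big_cat_nat _ _ _ T.+1) //=.
  by rewrite lerDl.
have /andP[B0 B1] := B.
have h4 : 4 * T%:R^-1 <= eps.
  have := HT T (leqnn T); rewrite ler_pdivrMr // => h.
  by rewrite ler_pdivrMr ?ltr0n // mulrC.
have Ti : 0 <= T%:R^-1 :> R by rewrite invr_ge0.
rewrite ger0_norm ?addr_ge0 //.
set x := \sum_(1 <= a < n.+1) (a%:R ^- 2) in full A1 B1 *.
set y := \sum_(T.+1 <= a < n.+1) (a%:R ^- 2) in tail A1 B1 *.
have xy : x * y <= 2 * T%:R^-1 := ler_pM (pos 1%N) (pos T.+1) full tail.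
by apply: le_trans (lerD B1 A1) _; rewrite [y * x]mulrC; lra.
Qed.

Lemma unif_approx_varX : unif_approx (fun n alpha => varX n alpha / n%:R ^+ 3).
Proof.
apply: unif_approx_close => eps e0.
exists (fun n alpha => full_var (1 - alpha) n / n%:R ^+ 3); split.
  exact: unif_approx_full_var.
have [N [N0 HN]] := archi_bound (2 / eps); exists N => n alpha Nn a01.
have n0 : 0 < n%:R :> R by rewrite ltr0n (leq_trans N0).
have n3 : 0 < n%:R ^+ 3 :> R by rewrite exprn_gt0.
have /andP[h0 h1] : 0 <= full_var (1 - alpha) n - varX n alpha <= 2 * n%:R ^+ 2.
  by apply: varX_full_var; lra.
rewrite -mulrBl normrM distrC (ger0_norm h0) ger0_norm ?invr_ge0 ?(ltW n3) //.
rewrite ler_pdivrMr //; apply: le_trans h1 _.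
have := HN n Nn; rewrite ler_pdivrMr // => h.
by rewrite [n%:R ^+ 3]exprS [leRHS]mulrA ler_wpM2r ?exprn_ge0 // mulrC.
Qed.

(** * Positivity of the limit *)

Lemma totient_sum_half_lower : exists N : nat, forall n, (N <= n)%N ->
  n%:R ^+ 3 / 50 <= totient_sum R 1 1 n - totient_sum R 1 1 (n %/ 2).
Proof.
have e1 : 0 < (100^-1 : R) by rewrite invr_gt0.
have [c [Q [Q0 HA]]] := @totient_ratio_mean R 1 1 _ isT isT e1.
(* The mean is at least 1/4 and c has precision 1/100; a smaller c is refuted at a large j, where
   the linear gap exceeds [Q]. *)
have c24 : 24 / 100 <= c.
  rewrite leNgt; apply/negP => cl.
  have d0 : 0 < 24 / 100 - c by lra.
  have [j [_ /(_ j.+1 (leqnSn j))]] := archi_bound ((Q + 1) / (24 / 100 - c)).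
  rewrite ler_pdivrMr // => jQ; have := HA j.+1; have := totient_ratio_mean_lower R j.+1.
  under [X in `|X - _|]eq_bigr do rewrite muln1.
  rewrite ler_norml => h /andP[_ h']; nra.
have HS := abel_sqr_mean (ltW e1) Q0 HA; set K := 2 * Q + `|c| in HS.
have SE k : totient_sum R 1 1 k = \sum_(1 <= g < k.+1)
    g%:R ^+ 2 * (totient_ratio R (g * 1) * totient_ratio R (g * 1)).
  by rewrite totient_sumE // mul1r.
have [N [N0 HN]] := archi_bound (100 * K); exists N => n Nn; rewrite !SE.
have := HS n; have := HS (n %/ 2)%N; rewrite !ler_norml.
set S2 := \sum_(1 <= g < (n %/ 2).+1) _; set S1 := \sum_(1 <= g < n.+1) _.
have K0 : 0 <= K by rewrite addr_ge0 ?mulr_ge0.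
have n0 : 0 <= n%:R :> R by [].
set k : R := (n %/ 2)%:R; have k0 : 0 <= k by [].
have kn : k <= n%:R / 2 by rewrite div_natr_le.
have k3 : k ^+ 3 <= n%:R ^+ 3 / 8.
  rewrite (_ : n%:R ^+ 3 / 8 = (n%:R / 2) ^+ 3); last by field.
  by rewrite lerXn2r ?nnegrE ?divr_ge0.
have k2 : K * k ^+ 2 <= K * n%:R ^+ 2.
  by rewrite ler_wpM2l // lerXn2r ?nnegrE //; lra.
have Kn : 100 * (K * n%:R ^+ 2) <= n%:R ^+ 3.
  by rewrite [n%:R ^+ 3]exprS mulrA ler_wpM2r ?exprn_ge0 // HN.
have ck3 : (c / 3 + 2 / 100) * k ^+ 3 <= (c / 3 + 2 / 100) * (n%:R ^+ 3 / 8).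
  by rewrite ler_wpM2l //; lra.
have cn : 24 / 100 * n%:R ^+ 3 <= c * n%:R ^+ 3 by rewrite ler_wpM2r ?exprn_ge0.
have n3 : 0 <= n%:R ^+ 3 :> R by rewrite exprn_ge0.
(* The main term is at least (24/300)(7/8) n^3 = 0.07 n^3. The errors are at most (2/100)(9/8) n^3
   plus twice n^3/100, which leaves more than n^3/50. *)
move=> /andP[_ h1] /andP[h2 _].
have h1' : S2 <= (c / 3 + 2 / 100) * k ^+ 3 + K * k ^+ 2 by lra.
lra.
Qed.

(** Only the diagonal terms d = e with n/2 < d <= n are kept, each of weight alpha (1 - alpha). The
    2/n pays for the index 1 in [full_var]. *)
Lemma varX_lower : exists N : nat, forall n (alpha : R), (N <= n)%N -> 0 < alpha < 1 ->
  alpha * (1 - alpha) / 100 <= varX n alpha / n%:R ^+ 3 + 2 / n%:R.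
Proof.
have [N HN] := totient_sum_half_lower.
exists N.+1 => n alpha Nn a01; have b01 : 0 <= 1 - alpha <= 1 by lra.
have a01' : 0 <= alpha <= 1 by lra.
have ab0 : 0 <= alpha * (1 - alpha) by rewrite mulr_ge0; lra.
have n1 : (0 < n)%N by apply: leq_ltn_trans Nn.
have n0 : 0 < n%:R :> R by rewrite ltr0n.
have n3 : 0 < n%:R ^+ 3 :> R by rewrite exprn_gt0.
have h1 : alpha * (1 - alpha) * (totient_sum R 1 1 n - totient_sum R 1 1 (n %/ 2))
    <= pair_sum (1 - alpha) 1 1 n.
  have := @totient_sum_fiber 1 1 1 n isT; rewrite divn1 => <-.
  rewrite mulr_sumr big_mkcond /pair_sum big_nat [leRHS]big_nat.
  apply: ler_sum => g /andP[g0 _]; case: ifP => [/eqP ->|_].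
    by rewrite /miss_weight !divn1 addnK expr1 mulrC; lra.
  by case/andP: (pair_term_le n b01 (isT : (0 < 1)%N) (isT : (0 < 1)%N) g0).
have h2 : pair_sum (1 - alpha) 1 1 n <= full_var (1 - alpha) n.
  have ps a b : (0 < a)%N -> (0 < b)%N -> 0 <= pair_sum (1 - alpha) a b n.
    exact: pair_sum_ge0.
  rewrite full_var_pair_sum big_ltn //.
  apply: le_trans (_ : _ <= \sum_(1 <= b < n.+1 | coprime 1 b)
                                pair_sum (1 - alpha) 1 b n) _.
    rewrite [leRHS]big_mkcond big_ltn //= lerDl big_nat.
    by apply: sumr_ge0 => b /andP[b1 _]; rewrite coprime1n ps // ltnW.
  rewrite lerDl big_nat; apply: sumr_ge0 => a /andP[a1 _].
  rewrite big_nat_cond; apply: sumr_ge0 => b /andP[/andP[b1 _] _].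
  by rewrite ps // ltnW.
have /andP[_ h3] := varX_full_var n a01'.
have h4 := ler_wpM2l ab0 (HN n (ltnW Nn)).
rewrite -(ler_pM2r n3) mulrDl divfK ?gt_eqF //.
have -> : 2 / n%:R * n%:R ^+ 3 = 2 * n%:R ^+ 2 :> R by field; rewrite gt_eqF.
have h5 : 0 <= alpha * (1 - alpha) * n%:R ^+ 3 by rewrite mulr_ge0 // ltW.
lra.
Qed.

End Limit.

Theorem theorem1p3 (R : realType) :
  (exists v : R -> R,
     (forall alpha : R, 0 < alpha < 1 -> 0 < v alpha) /\
     (forall eps : R, 0 < eps ->
        exists M : R, 0 < M /\
          forall (n : nat) (alpha : R), (3 <= n)%N -> 0 < alpha < 1 ->
            M <= alpha * n%:R / ((ln (n%:R : R)) ^+ 3 * ln (ln (n%:R : R))) ->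
            `| varX n alpha / n%:R ^+ 3 - v alpha | <= eps))
  /\
  (exists C : R, 0 < C /\
     forall (n : nat) (alpha : R), (1 <= n)%N -> 0 <= alpha <= 1 ->
       varX n alpha <= C * alpha * n%:R ^+ 3).
Proof.
split; last first.
  exists 4; split=> // n alpha _ a01.
  apply: le_trans (full_var_le n a01).
  by have /andP[h _] := varX_full_var n a01; rewrite -subr_ge0.
have [v Hv] := unif_approx_lim (@unif_approx_varX R).
exists v; split=> [alpha a01|eps e0].
  have [N HN] := varX_lower R.
  pose d := alpha * (1 - alpha) / 100.
  have d0 : 0 < d by rewrite divr_gt0 // mulr_gt0; lra.
  have d4 : 0 < d / 4 by rewrite divr_gt0.
  have [N' HN'] := Hv _ d4.
  have [N3 [N30 HN3]] := archi_bound (4 / d).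
  (* At this single n the normalised variance is at least d - d/2 and within d/4 of the limit, so
     the limit is at least d/4. *)
  pose n := maxn N3 (maxn N N').
  have n0 : 0 < n%:R :> R by rewrite ltr0n (leq_trans N30) // leq_maxl.
  have := HN n alpha; rewrite -/d => /(_ _ a01) h1.
  have h2 := HN' n alpha _ a01.
  have h3 : 2 / n%:R <= d / 2.
    have := HN3 n (leq_maxl _ _); rewrite ler_pdivrMr // ler_pdivrMr //; lra.
  move: h1 h2; rewrite !(leq_trans _ (leq_maxr N3 _)) ?leq_maxl ?leq_maxr //.
  by move=> /(_ isT) h1 /(_ isT); rewrite ler_norml; lra.
have [N HN] := Hv _ e0.
pose D (n : nat) : R := ln (n%:R : R) ^+ 3 * ln (ln (n%:R : R)).
(* Exceeds |n / D(n)| for each n < N, so with alpha < 1 the growth condition fails there. Absolute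
   values cover small n, where the iterated logarithm may be negative or a default value. *)
pose M : R := 1 + \sum_(n < N) `|n%:R / D n|.
have S0 : 0 <= \sum_(n < N) `|n%:R / D n| by apply: sumr_ge0.
exists M; split=> [|n alpha _ a01 Mn]; first by rewrite /M; lra.
apply: HN => //; rewrite leqNgt; apply/negP => nN.
have : `|n%:R / D n| <= M - 1.
  rewrite /M addrAC subrr add0r (bigD1 (Ordinal nN)) //= lerDl.
  exact: sumr_ge0.
apply/negP; rewrite -ltNge; apply: (lt_le_trans (y := M)); first by lra.
apply: le_trans Mn _; rewrite -/(D n) -mulrA; apply: le_trans (ler_norm _) _.
rewrite normrM ger0_norm; last by lra.
by rewrite ler_piMl //; lra.
Qed.
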